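(* Let $p\in(0,1)$ be a fixed constant and let $\alpha,\beta\ge 0$ be fixed real numbers. For an even integer $n=2s$, let $M$ be the $n\times n$ matrix with $m_{ij}=p$ if $1\le|i-j|\le s-1$ and $0$ otherwise, and let $\widehat M$ be a random symmetric $n\times n$ matrix with zero diagonal whose entries $\widehat m_{ij}$, $i<j$, are independent Bernoulli variables with $\mathbb P(\widehat m_{ij}=1)=m_{ij}$. Let $u\in\mathbb R^n$ be given by $u_j=\cos\left(\frac{(2j-1)\pi}{4s+2}\right)$ for $j=1,\dots,s$ and $u_j=-u_{n-j+1}$ for $j=s+1,\dots,n$, and let $y$ be a unit eigenvector of $\widehat M$ for $\lambda_2(\widehat M)$ with sign chosen so that $\langle y,u\rangle\ge0$. Let $r=n^{\alpha}$ and $k=n^{\beta}$. Then there is a constant $C>0$ (independent of $n$) such that, with probability at least $1-n^{-3}$: if $\alpha\le\beta$ then $D_{k,r}(y)<Cn^{5-2(\alpha+\beta)}$, and if $\alpha>\beta$ then $D_{k,r}(y)<Cn^{5-4\beta}$.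
   Context: Eigenvalues of a symmetric matrix $X$ are labelled so that $|\lambda_1(X)|\ge|\lambda_2(X)|\ge\dots$; $\lambda_2(X)$ is the one of second largest absolute value. For a vector $y\in\mathbb R^n$ and reals $k,r$, the refined Kendall distance is \[ D_{k,r}(y)=\left|\{(i,j): y_j>y_i,\ i+k\le j,\ r\le i\}\right|, \] i.e. the number of pairs of indices at least $k$ apart, with the smaller index at least $r$, that are out of the (decreasing) order. *)

(* Defs.v *)
From HB Require Import structures.
From mathcomp Require Import all_boot all_order all_algebra.
From mathcomp Require Import all_classical all_reals all_analysis.
Set Implicit Arguments. Unset Strict Implicit. Unset Printing Implicit Defensive.
Import Order.TTheory GRing.Theory Num.Theory.
Local Open Scope ring_scope.

Section Defs.
Variable R : realType.

Definition ndist (i j : nat) : nat := (maxn i j - minn i j)%N.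

Definition Mexp (p : R) (s : nat) : 'M[R]_(s.*2) :=
  \matrix_(i, j) (if (0 < ndist i j <= s.-1)%N then p else 0).

Definition bern (q : R) (b : bool) : R := if b then q else 1 - q.

(* Sample space: one Bernoulli bit for each ordered pair; only pairs i<j are
   random (success prob m_ij), pairs with i >= j are a.s. false. *)
Definition weight (p : R) (s : nat) (w : {ffun 'I_(s.*2) * 'I_(s.*2) -> bool}) : R :=
  \prod_(e : 'I_(s.*2) * 'I_(s.*2))
     bern (if (e.1 < e.2)%N then Mexp p s e.1 e.2 else 0) (w e).

Definition Mhat (s : nat) (w : {ffun 'I_(s.*2) * 'I_(s.*2) -> bool}) : 'M[R]_(s.*2) :=
  \matrix_(i, j) (if (i < j)%N then (w (i, j))%:R
                  else if (j < i)%N then (w (j, i))%:R else 0).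

Definition Prob (p : R) (s : nat) (E : {ffun 'I_(s.*2) * 'I_(s.*2) -> bool} -> Prop) : R :=
  \sum_(w | `[< E w >]) weight p w.

(* l is lambda_2(X) for some labelling |l_1| >= |l_2| >= ... of the eigenvalues
   of X (with multiplicity, i.e. roots of the characteristic polynomial). *)
Definition is_lambda2 (n : nat) (X : 'M[R]_n) (l : R) : Prop :=
  exists sq : seq R,
    char_poly X = \prod_(x <- sq) ('X - x%:P) /\
    sorted (fun a b => `|b| <= `|a|) sq /\ nth 0 sq 1 = l.

(* The vector u (0-based index i corresponds to j = i+1). *)
Definition uvec (s : nat) : 'cV[R]_(s.*2) :=
  \col_(i < s.*2)
    (if (i < s)%N then cos ((2 * i%:R + 1) * pi / (4 * s%:R + 2))
     else - cos ((2 * (s.*2 - 1 - i)%N%:R + 1) * pi / (4 * s%:R + 2))).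

Definition dotv (n : nat) (x y : 'cV[R]_n) : R := \sum_i x i 0 * y i 0.

(* Refined Kendall distance, 1-based indices: pairs (i,j) with y_j > y_i,
   i + k <= j, r <= i. *)
Definition Dkr (n : nat) (k r : R) (y : 'cV[R]_n) : nat :=
  #|[set ij : 'I_n * 'I_n |
      [&& y ij.1 0 < y ij.2 0,
          (ij.1.+1)%:R + k <= (ij.2.+1)%:R & r <= (ij.1.+1)%:R]]|.

End Defs.

(* Main.v *)
Require Import Defs.
From HB Require Import structures.
From mathcomp Require Import all_boot all_order all_algebra.
From mathcomp Require Import all_classical all_reals all_analysis.
From mathcomp Require Import ring lra zify.
Import Order.TTheory GRing.Theory Num.Theory.
Import numFieldNormedType.Exports.
Local Open Scope ring_scope.
Set Implicit Arguments. Unset Strict Implicit. Unset Printing Implicit Defensive.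

(** The vector u is an eigenvector of M = [Mexp p s], for an eigenvalue mu close
to p n / pi, and, T = p s being the scale, the Rayleigh quotient of M at the
constant vector q is about 3 T / 2. As the squared Frobenius norm of M is at
most 3 T ^ 2 < (3 T / 2) ^ 2 + 2 mu ^ 2, any unit vector z orthogonal to u is
far from being an eigenvector for an eigenvalue of modulus about mu. With
E = Mhat - M, an exponential moment bound and union bounds over finite grids
show that, up to probability 2 exp (- n), |E x| <= c T |x| for all x, with a
tiny constant c, and |E u| = O(sqrt n |u|). The first estimate locates
lambda_2 near mu in modulus by min-max; a Davis-Kahan argument, which sees the
error only through E u, then gives |y - u / |u| | ^ 2 = O(1 / n). Finally,
coordinates of u / |u| with indices at least k apart differ by at least a
constant times n ^ (-1/2) (k / n) ^ 2, so every inverted pair costs k ^ 4 / n ^ 5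
in squared error, and each index occurs in at most 2 n pairs: the number of
inverted pairs is O(n ^ 5 / k ^ 4), which is at most the claimed bound in both
cases. *)

(** * Euclidean inner product and norm on column vectors *)

Section Euclidean.
Variables (R : realType) (n : nat).
Implicit Types (x y z : 'cV[R]_n) (a : R).

Lemma dotvC x y : dotv x y = dotv y x.
Proof. by apply: eq_bigr => i _; rewrite mulrC. Qed.

Lemma dotvDl x y z : dotv (x + y) z = dotv x z + dotv y z.
Proof. by rewrite -big_split; apply: eq_bigr => i _; rewrite mxE mulrDl. Qed.

Lemma dotvDr x y z : dotv z (x + y) = dotv z x + dotv z y.
Proof. by rewrite dotvC dotvDl !(dotvC z). Qed.

Lemma dotvZl a x y : dotv (a *: x) y = a * dotv x y.
Proof. by rewrite mulr_sumr; apply: eq_bigr => i _; rewrite mxE mulrA. Qed.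

Lemma dotvZr a x y : dotv x (a *: y) = a * dotv x y.
Proof. by rewrite dotvC dotvZl dotvC. Qed.

Lemma dotvNl x y : dotv (- x) y = - dotv x y.
Proof. by rewrite -scaleN1r dotvZl mulN1r. Qed.

Lemma dotvNr x y : dotv x (- y) = - dotv x y.
Proof. by rewrite dotvC dotvNl dotvC. Qed.

Definition dotvE := (dotvDl, dotvDr, dotvNl, dotvNr, dotvZl, dotvZr).

Lemma dotv0 x : dotv x 0 = 0.
Proof. by apply: big1 => i _; rewrite mxE mulr0. Qed.

Lemma dotv_ge0 x : 0 <= dotv x x.
Proof. by apply: sumr_ge0 => i _; rewrite -expr2 sqr_ge0. Qed.
Hint Resolve dotv_ge0 : core.

Lemma dotv_eq0 x : (dotv x x == 0) = (x == 0).
Proof.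
apply/idP/eqP => [|->]; last by apply/eqP/big1 => i _; rewrite !mxE mul0r.
rewrite psumr_eq0 => [|i _]; last by rewrite -expr2 sqr_ge0.
move=> /allP h; apply/colP => i.
by have := h i (mem_index_enum _); rewrite -expr2 sqrf_eq0 mxE => /eqP.
Qed.

Lemma dotv_CS x y : dotv x y ^+ 2 <= dotv x x * dotv y y.
Proof.
have [->|y0] := eqVneq y 0.
  by rewrite !dotv0 expr0n mulr0.
have ypos : 0 < dotv y y by rewrite lt_neqAle eq_sym dotv_eq0 y0 dotv_ge0.
have := dotv_ge0 (dotv y y *: x - dotv x y *: y).
rewrite !dotvE (dotvC y x).
set a := dotv x x; set b := dotv x y; set c := dotv y y.
rewrite (_ : _ + _ = c * (a * c - b ^+ 2)); last by ring.
by rewrite pmulr_rge0 // subr_ge0.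
Qed.

Definition nrm x := Num.sqrt (dotv x x).

Lemma nrm_ge0 x : 0 <= nrm x. Proof. exact: sqrtr_ge0. Qed.
Hint Resolve nrm_ge0 : core.

Lemma sqr_nrm x : nrm x ^+ 2 = dotv x x. Proof. exact: sqr_sqrtr. Qed.

Lemma nrm_le x a : 0 <= a -> (nrm x <= a) = (dotv x x <= a ^+ 2).
Proof. by move=> a0; rewrite -sqr_nrm ler_pXn2r // nnegrE. Qed.

Lemma nrm_ge x a : 0 <= a -> (a <= nrm x) = (a ^+ 2 <= dotv x x).
Proof. by move=> a0; rewrite -sqr_nrm ler_pXn2r // nnegrE. Qed.

Lemma normr_dotv_le x y : `|dotv x y| <= nrm x * nrm y.
Proof. by rewrite -(@ler_pXn2r _ 2) ?nnegrE ?mulr_ge0 // exprMn !sqr_nrm real_normK ?num_real ?dotv_CS. Qed.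

Lemma dotv_le x y : dotv x y <= nrm x * nrm y.
Proof. exact: le_trans (ler_norm _) (normr_dotv_le x y). Qed.

Lemma nrmN x : nrm (- x) = nrm x.
Proof. by rewrite /nrm !dotvE opprK. Qed.

Lemma nrmZ a x : nrm (a *: x) = `|a| * nrm x.
Proof. by rewrite /nrm !dotvE mulrA sqrtrM ?sqr_ge0 // -expr2 sqrtr_sqr. Qed.

Lemma nrmD x y : nrm (x + y) <= nrm x + nrm y.
Proof.
rewrite nrm_le ?addr_ge0 // !dotvE (dotvC y x) sqrrD !sqr_nrm.
by have := dotv_le x y; lra.
Qed.

Lemma nrmB x y : nrm x - nrm y <= nrm (x - y).
Proof. by rewrite lerBlDr; apply: le_trans (nrmD _ _); rewrite subrK. Qed.

Lemma nrm_eq0 x : (nrm x == 0) = (x == 0).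
Proof. by rewrite -dotv_eq0 -sqr_nrm sqrf_eq0. Qed.

Lemma nrm_gt0 x : (0 < nrm x) = (x != 0).
Proof. by rewrite lt_neqAle nrm_ge0 eq_sym nrm_eq0 andbT. Qed.

(** Expand the square of x minus its three components. Norms at most 1, rather than equal to 1, let
    a zero vector stand in for a missing one. *)
Lemma bessel3 (a b c x : 'cV[R]_n) :
  dotv a a <= 1 -> dotv b b <= 1 -> dotv c c <= 1 ->
  dotv a b = 0 -> dotv a c = 0 -> dotv b c = 0 ->
  dotv x a ^+ 2 + dotv x b ^+ 2 + dotv x c ^+ 2 <= dotv x x.
Proof.
move=> aa bb cc ab ac bc.
have := dotv_ge0 (x - dotv x a *: a - dotv x b *: b - dotv x c *: c).
rewrite !dotvE (dotvC b a) (dotvC c a) (dotvC c b) ab ac bc.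
rewrite (dotvC a x) (dotvC b x) (dotvC c x).
move: aa bb cc; rewrite -subr_ge0 => /(mulr_ge0 (sqr_ge0 (dotv x a))) aa.
rewrite -subr_ge0 => /(mulr_ge0 (sqr_ge0 (dotv x b))) bb.
rewrite -subr_ge0 => /(mulr_ge0 (sqr_ge0 (dotv x c))) cc.
by move: (dotv x a) (dotv x b) (dotv x c) aa bb cc => r s t; lra.
Qed.

End Euclidean.

Global Hint Extern 0 (is_true (0 <= dotv _ _)) => exact: dotv_ge0 : core.
Global Hint Extern 0 (is_true (0 <= nrm _)) => exact: nrm_ge0 : core.

(** * Frobenius norm and orthogonal families *)

Section Matrices.
Variables (R : realType).

Lemma dotv_mx n (x y : 'cV[R]_n) : dotv x y = (x^T *m y) 0 0.
Proof. by rewrite mxE; apply: eq_bigr => i _; rewrite mxE. Qed.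

Lemma dotv_mulmxl m n (A : 'M[R]_(m, n)) (x : 'cV[R]_n) (y : 'cV[R]_m) :
  dotv (A *m x) y = dotv x (A^T *m y).
Proof. by rewrite !dotv_mx trmx_mul mulmxA. Qed.

Definition frob2 m n (A : 'M[R]_(m, n)) := \sum_i \sum_j A i j ^+ 2.

Lemma mulmx_rowE m n (A : 'M[R]_(m, n)) (x : 'cV[R]_n) i :
  (A *m x) i 0 = dotv (row i A)^T x.
Proof. by rewrite mxE; apply: eq_bigr => j _; rewrite !mxE. Qed.

Lemma frob2_row m n (A : 'M[R]_(m, n)) :
  frob2 A = \sum_i dotv (row i A)^T (row i A)^T.
Proof.
by apply: eq_bigr => i _; apply: eq_bigr => j _; rewrite !mxE expr2.
Qed.

Lemma frob2_ge m n (A : 'M[R]_(m, n)) (x : 'cV[R]_n) :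
  dotv (A *m x) (A *m x) <= frob2 A * dotv x x.
Proof.
rewrite frob2_row mulr_suml; apply: ler_sum => i _.
by rewrite mulmx_rowE -expr2 dotv_CS.
Qed.

(** Bessel's inequality on each row. The Frobenius norm thus acts as a budget: what two directions
    consume is lost to every vector orthogonal to them. *)
Lemma frob2_ge3 m n (A : 'M[R]_(m, n)) (a b c : 'cV[R]_n) :
  dotv a a <= 1 -> dotv b b <= 1 -> dotv c c <= 1 ->
  dotv a b = 0 -> dotv a c = 0 -> dotv b c = 0 ->
  dotv (A *m a) (A *m a) + dotv (A *m b) (A *m b) + dotv (A *m c) (A *m c)
    <= frob2 A.
Proof.
move=> *; rewrite frob2_row -!big_split; apply: ler_sum => i _ /=.
by rewrite !mulmx_rowE -!expr2 bessel3.
Qed.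

Lemma frob2_ge3Z m n (A : 'M[R]_(m, n)) (a b c : 'cV[R]_n) :
  dotv a a = 1 -> dotv b b = 1 ->
  dotv a b = 0 -> dotv a c = 0 -> dotv b c = 0 ->
  (dotv (A *m a) (A *m a) + dotv (A *m b) (A *m b)) * dotv c c
    + dotv (A *m c) (A *m c) <= frob2 A * dotv c c.
Proof.
move=> aa bb ab ac bc; have [->|c0] := eqVneq c 0.
  by rewrite mulmx0 !dotv0 !mulr0 addr0.
have cc : 0 < dotv c c by rewrite lt_neqAle eq_sym dotv_eq0 c0 dotv_ge0.
have cn : 0 < nrm c by rewrite nrm_gt0.
have cE := sqr_nrm c.
rewrite -ler_pdivrMr // mulrDl mulfK ?gt_eqF //.
have := @frob2_ge3 _ _ A a b ((nrm c)^-1 *: c).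
rewrite -!scalemxAr !dotvE aa bb ab ac bc !mulr0 lexx.
have -> : (nrm c)^-1 * ((nrm c)^-1 * dotv c c) = 1.
  by rewrite -cE; field; rewrite gt_eqF.
move/(_ isT isT (lexx _) erefl erefl erefl).
suff -> : (nrm c)^-1 * ((nrm c)^-1 * dotv (A *m c) (A *m c)) =
  dotv (A *m c) (A *m c) / dotv c c by [].
by rewrite -cE; field; rewrite gt_eqF.
Qed.

End Matrices.

(** * Spectral theorem for real symmetric matrices *)

Section Diagonalisation.
Variable R : realType.

Lemma char_poly_conj n (A P Q : 'M[R]_n) :
  P *m Q = 1%:M -> char_poly (P *m A *m Q) = char_poly A.
Proof.
move=> PQ; rewrite /char_poly.
have mPQ : map_mx polyC P *m map_mx polyC Q = 1%:M.
  by rewrite -map_mxM PQ map_scalar_mx.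
have -> : char_poly_mx (P *m A *m Q) =
    map_mx polyC P *m char_poly_mx A *m map_mx polyC Q.
  rewrite /char_poly_mx mulmxBr mulmxBl -!map_mxM; congr (_ - _).
  by rewrite scalar_mxC -mulmxA mPQ mulmx1.
by rewrite !det_mulmx mulrAC -det_mulmx mPQ det1 mul1r.
Qed.

(** [H] is the reflection in the hyperplane orthogonal to v - e, with e the first basis vector, or
    the identity when v = e. *)
Lemma householder n (v : 'cV[R]_n.+1) : dotv v v = 1 ->
  exists H : 'M[R]_n.+1,
    [/\ H^T = H, H *m H = 1%:M & H *m v = delta_mx 0 0].
Proof.
move=> vv; pose e : 'cV[R]_n.+1 := delta_mx 0 0.
have ve : dotv v e = v 0 0.
  rewrite /dotv (bigD1 0) //= big1 ?mxE ?eqxx ?mulr1 ?addr0 // => i /negPf i0.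
  by rewrite mxE i0 mulr0.
have ee : dotv e e = 1.
  rewrite /dotv (bigD1 0) //= big1 ?mxE ?eqxx ?mulr1 ?addr0 // => i /negPf i0.
  by rewrite mxE i0 mulr0.
have [->|ne] := eqVneq v e; first by exists 1%:M; rewrite trmx1 !mul1mx.
pose w := v - e.
have ww0 : dotv w w != 0 by rewrite dotv_eq0 subr_eq0.
have wmx : w^T *m w = (dotv w w)%:M.
  by rewrite [LHS]mx11_scalar -dotv_mx.
pose c := 2 / dotv w w.
exists (1%:M - c *: (w *m w^T)); split.
- by rewrite linearB linearZ /= trmx1 trmx_mul trmxK.
- have WW : w *m w^T *m (w *m w^T) = dotv w w *: (w *m w^T).
    by rewrite mulmxA -(mulmxA w) wmx mul_mx_scalar -scalemxAl.
  move: (w *m w^T) WW => W WW.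
  rewrite mulmxBl mul1mx -scalemxAl mulmxBr mulmx1 -scalemxAr WW.
  rewrite scalerBr !scalerA -addrA -opprD -scalerBl -scalerDl.
  suff -> : c + (c - c * c * dotv w w) = 0 by rewrite scale0r subr0.
  by rewrite /c; field.
- rewrite mulmxBl mul1mx -scalemxAl -mulmxA [w^T *m v]mx11_scalar -dotv_mx.
  rewrite mul_mx_scalar scalerA.
  (* Since v and e are unit vectors, [dotv w w] is twice [dotv w v]. *)
  suff -> : c * dotv w v = 1 by rewrite scale1r opprB addrC subrK.
  move: ww0; rewrite /c /w !dotvE (dotvC e v) vv ve ee => ww0.
  by rewrite mulrAC -[RHS](divff ww0); congr (_ / _); ring.
Qed.

Lemma block_diag_mul m n (a c : 'M[R]_m) (b d : 'M[R]_n) :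
  block_mx a 0 0 b *m block_mx c 0 0 d = block_mx (a *m c) 0 0 (b *m d).
Proof. by rewrite mulmx_block !(mulmx0, mul0mx, addr0, add0r). Qed.

(** Deflation: a reflection sends a unit eigenvector for the head of [sq] to the first basis vector,
    symmetry makes the conjugate block diagonal, and cancelling one linear factor leaves the tail of
    [sq] for the smaller block. The diagonal thus follows the prescribed order of [sq], as the
    labelling by modulus requires. *)
Lemma sym_diagonalise n (A : 'M[R]_n) (sq : seq R) : A^T = A ->
  char_poly A = \prod_(x <- sq) ('X - x%:P) ->
  exists P : 'M[R]_n,
    P *m P^T = 1%:M /\ P *m A *m P^T = diag_mx (\row_i sq`_i).
Proof.
elim: n A sq => [|n IHn] A sq symA cA.
  by exists 1%:M; rewrite !(thinmx0 1%:M) !flatmx0 // [RHS]flatmx0.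
have ssq : size sq = n.+1.
  have := size_char_poly A; rewrite cA size_prod_XsubC.
  by case.
case: sq ssq cA => // x sq [ssq]; rewrite big_cons => cA.
have /eigenvalueP [v0 v0A v0n] : eigenvalue A x.
  by rewrite eigenvalue_root_char cA rootM root_XsubC eqxx.
pose v := (nrm v0^T)^-1 *: v0^T.
have nv0 : nrm v0^T != 0.
  by rewrite nrm_eq0; apply: contra v0n => /eqP h; rewrite -[v0]trmxK h trmx0.
have vv : dotv v v = 1.
  by rewrite /v !dotvE -sqr_nrm; field.
have Av : A *m v = x *: v.
  by rewrite /v -scalemxAr -{1}symA -trmx_mul v0A linearZ /= !scalerA mulrC.
have [H [symH HH Hv]] := householder vv.
pose B := H *m A *m H.
have symB : B^T = B by rewrite /B !trmx_mul symH symA mulmxA.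
have Be : B *m delta_mx 0 0 = x *: (delta_mx 0 0 : 'cV_n.+1).
  by rewrite -Hv /B -!mulmxA (mulmxA H H) HH mul1mx Av -scalemxAr.
have B0 i : B i 0 = (if i == 0 then x else 0).
  have /matrixP/(_ i 0) := Be; rewrite -colE !mxE => ->.
  by rewrite eqxx andbT; case: eqP => _; rewrite ?mulr1 ?mulr0.
have BE : H *m A *m H = B by [].
have cB0 : char_poly B = char_poly A by apply: char_poly_conj.
clearbody B.
(* The same matrix at the convertible size [1 + n], where block operations apply; both [change]
   below rely on this conversion. *)
pose B' : 'M[R]_(1 + n) := B.
pose C := drsubmx B'.
have Bblock : B' = block_mx x%:M 0 0 C.
  rewrite -[LHS]submxK /C; congr block_mx.
  - apply/matrixP=> i j; rewrite !ord1 !mxE mulr1n.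
    by have := B0 0; rewrite eqxx => <-; congr (B _ _); apply/val_inj.
  - apply/matrixP=> i j; rewrite !mxE.
    have := B0 (rshift 1 j); rewrite -val_eqE /= => <-.
    by rewrite -[in RHS]symB mxE; congr (B _ _); apply/val_inj; rewrite /= ?ord1.
  - apply/matrixP=> i j; rewrite !mxE.
    have := B0 (rshift 1 i); rewrite -val_eqE /= => <-.
    by congr (B _ _); apply/val_inj; rewrite /= ?ord1.
have symC : C^T = C by rewrite /C trmx_drsub; congr drsubmx; exact: symB.
have cB : char_poly B' = ('X - x%:P) * \prod_(y <- sq) ('X - y%:P).
  by rewrite -cA -cB0.
have cC : char_poly C = \prod_(y <- sq) ('X - y%:P).
  move: cB; rewrite Bblock /char_poly char_block_diag_mx det_ublock.
  rewrite {1}/char_poly_mx map_scalar_mx -rmorphB /= det_scalar1.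
  by apply: mulfI; rewrite polyXsubC_eq0.
have [P' [PP' PCP]] := IHn C sq symC cC.
pose Q : 'M[R]_(1 + n) := block_mx 1%:M 0 0 P'.
have trQ : Q^T = block_mx 1%:M 0 0 P'^T by rewrite /Q tr_block_mx trmx1 !trmx0.
exists ((Q : 'M[R]_n.+1) *m H); split.
  rewrite trmx_mul symH mulmxA -(mulmxA _ H H) HH mulmx1.
  change (Q *m Q^T = 1%:M).
  by rewrite trQ /Q block_diag_mul PP' mul1mx -scalar_mx_block.
rewrite trmx_mul symH !mulmxA -(mulmxA _ H A) -(mulmxA _ (H *m A) H) BE.
change (Q *m B' *m Q^T = diag_mx (\row_i (x :: sq)`_i)).
rewrite trQ Bblock /Q !block_diag_mul PCP mul1mx mulmx1.
apply/matrixP => i j; rewrite !mxE.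
case: (splitP i) => i' ei; case: (splitP j) => j' ej; rewrite !mxE;
  case: (splitP _) => // k ek; rewrite ?mxE -?val_eqE /= ?ei ?ej ?ord1 ?mul0rn //.
- by move: ek; rewrite ej ord1.
- by move: ek; rewrite ej ord1.
- by move: ek; rewrite ej ord1.
- by move: ek; rewrite ej ord1.
- by move: ek; rewrite ej !add1n => -[] <-.
Qed.
End Diagonalisation.

(** * Variational description of the second eigenvalue *)

Section MinMax.
Variable R : realType.

Lemma dotv_delta n (w : 'cV[R]_n) i : dotv w (delta_mx i 0) = w i 0.
Proof.
rewrite /dotv (bigD1 i) //= big1 ?mxE ?eqxx ?mulr1 ?addr0 // => j /negPf ji.
by rewrite mxE ji mulr0.
Qed.

(** A certificate that |l| is the second largest singular value, blind to the sign of l: A stretches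
    by at least |l| on the plane of [v1] and [v2], and by at most |l| on the complement of [v1]. *)
Definition second_singular n (A : 'M[R]_n) (l : R) :=
  exists v1 v2 : 'cV[R]_n,
  [/\ dotv v1 v1 = 1, dotv v2 v2 = 1, dotv v1 v2 = 0,
      (forall a b, l ^+ 2 * (a ^+ 2 + b ^+ 2) <=
         dotv (A *m (a *: v1 + b *: v2)) (A *m (a *: v1 + b *: v2))) &
      (forall w, dotv w v1 = 0 ->
         dotv (A *m w) (A *m w) <= l ^+ 2 * dotv w w)].

(** Take eigenvectors for the first two entries of the sorted list: in eigencoordinates the squared
    norm of A w is a sum of squares weighted by the squared eigenvalues, which decrease. *)
Lemma is_lambda2_second_singular n (A : 'M[R]_n) l :
  A^T = A -> (1 < n)%N -> is_lambda2 A l -> second_singular A l.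
Proof.
move=> symA n1 [sq [cA [srt lE]]].
have ssq : size sq = n.
  by have := size_char_poly A; rewrite cA size_prod_XsubC => -[].
have [P [PP PAP]] := sym_diagonalise symA cA.
have PP' : P^T *m P = 1%:M by apply: mulmx1C.
have isoT (x y : 'cV[R]_n) : dotv (P^T *m x) (P^T *m y) = dotv x y.
  by rewrite dotv_mulmxl trmxK mulmxA PP mul1mx.
have iso (x y : 'cV[R]_n) : dotv (P *m x) (P *m y) = dotv x y.
  by rewrite dotv_mulmxl mulmxA PP' mul1mx.
have normA w : dotv (A *m w) (A *m w) =
    \sum_(i < n) sq`_i ^+ 2 * (P *m w) i 0 ^+ 2.
  rewrite -iso (_ : P *m (A *m w) = P *m A *m P^T *m (P *m w)).
    rewrite PAP mul_diag_mx; apply: eq_bigr => i _; rewrite !mxE.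
    by move: (\sum_j _) => c; ring.
  by rewrite -!mulmxA (mulmxA P^T) PP' mul1mx.
have normw w : dotv w w = \sum_i (P *m w) i 0 ^+ 2.
  by rewrite -iso; apply: eq_bigr => i _; rewrite expr2.
have mono i j : (i <= j < n)%N -> sq`_j ^+ 2 <= sq`_i ^+ 2.
  move=> /andP[ij jn].
  rewrite -[X in X <= _]real_normK ?num_real // -[X in _ <= X]real_normK ?num_real //.
  rewrite ler_pXn2r ?nnegrE //.
  apply: (sorted_leq_nth _ _ _ srt) => //; rewrite ?inE ?ssq //.
  - by move=> a b c ba cb; apply: le_trans cb ba.
  - exact: leq_ltn_trans ij jn.
pose i0 := Ordinal (ltnW n1); pose i1 := Ordinal n1.
exists (P^T *m delta_mx i0 0), (P^T *m delta_mx i1 0); split.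
- by rewrite isoT dotv_delta mxE !eqxx.
- by rewrite isoT dotv_delta mxE !eqxx.
- by rewrite isoT dotv_delta mxE.
- move=> a b; rewrite normA.
  have PE : P *m (a *: (P^T *m delta_mx i0 0) + b *: (P^T *m delta_mx i1 0)) =
      a *: delta_mx i0 0 + b *: delta_mx i1 0 :> 'cV[R]_n.
    by rewrite mulmxDr -!scalemxAr !mulmxA PP !mul1mx.
  rewrite PE -lE (bigD1 i0) //= (bigD1 i1) //= addrA ler_wpDr //.
    by apply: sumr_ge0 => i _; rewrite mulr_ge0 ?sqr_ge0.
  rewrite !mxE !eqxx /= !(mulr1, mulr0, addr0, add0r) mulrDr lerD2r.
  by rewrite ler_wpM2r ?sqr_ge0 // mono.
- move=> w; rewrite dotvC dotv_mulmxl trmxK dotvC dotv_delta => w0.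
  rewrite normA normw mulr_sumr; apply: ler_sum => i _.
  have [->|ii0] := eqVneq i i0; first by rewrite w0 expr0n !mulr0.
  rewrite ler_wpM2r ?sqr_ge0 // -lE; apply: mono.
  by rewrite ltn_ord andbT lt0n; move: ii0; rewrite -val_eqE.
Qed.

(** The dimension count behind min-max: a plane contains a nonzero vector on which a given linear
    form, with values x and y on a basis, vanishes. *)
Lemma lin_dep2 (x y : R) :
  exists a b : R, 0 < a ^+ 2 + b ^+ 2 /\ a * x + b * y = 0.
Proof.
have [->|x0] := eqVneq x 0.
  by exists 1, 0; split; [rewrite expr1n expr0n addr0 ltr01 | rewrite mulr0 mul0r addr0].
exists (- y), x; split; last by ring.
by rewrite ltr_wpDl ?sqr_ge0 // lt_neqAle sqr_ge0 andbT eq_sym sqrf_eq0.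
Qed.

End MinMax.

(** * Deterministic perturbation of the second eigenvector *)

Section Perturbation.
Variables (R : realType) (n : nat).
Local Notation eps := ((1 / 10) ^+ 3 : R).
Implicit Types (M A : 'M[R]_n) (U q w y z : 'cV[R]_n) (mu l T : R).

(** The profile of the expected matrix after division by T. The constant 5 / 8 lies just below 2 /
    pi, the limit of mu, while 3 / 2 and 3 are the limits of the other two quantities; [q] is known
    only through its Rayleigh quotient. *)
Definition two_level M U q mu :=
  [/\ M^T = M, [/\ dotv U U = 1, dotv q q = 1 & dotv q U = 0],
      M *m U = mu *: U, 5 / 8 - eps <= mu &
      3 / 2 - eps <= dotv (M *m q) q /\ frob2 M <= 3].

Lemma two_level_q M U q mu : two_level M U q mu ->
  9 / 4 - 3 * eps <= dotv (M *m q) (M *m q).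
Proof.
move=> [symM [UU qq qU] MU muge [Mq F]].
by have := dotv_CS (M *m q) q; rewrite qq mulr1; nra.
Qed.

Lemma two_level_U M U q mu : two_level M U q mu ->
  dotv (M *m U) (M *m U) = mu ^+ 2.
Proof.
by move=> [symM [UU qq qU] MU muge _]; rewrite MU !dotvE UU mulr1 expr2.
Qed.

(** The Frobenius budget 3, less about 9 / 4 spent on [q], leaves about 3 / 4 for mu ^ 2, just under
    (7 / 8) ^ 2. *)
Lemma two_level_mu M U q mu : two_level M U q mu -> mu <= 7 / 8.
Proof.
move=> H; have := two_level_q H; have := two_level_U H.
case: H => [symM [UU qq qU] MU muge [Mq F]] MUU Mqq.
have := @frob2_ge3 _ _ _ M q U 0.
rewrite UU qq mulmx0 !dotv0 qU lexx ler01 MUU.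
move=> /(_ isT isT isT erefl erefl erefl); nra.
Qed.

(** Split off the component of w along [U], where M acts as mu. On the rest, orthogonal to both [q]
    and [U], the budget leaves about 3 / 4 - mu ^ 2, which is below mu ^ 2 because 2 (5 / 8) ^ 2 > 3
    / 4. *)
Lemma two_level_perp M U q mu w : two_level M U q mu -> dotv w q = 0 ->
  dotv (M *m w) (M *m w) <= mu ^+ 2 * dotv w w.
Proof.
move=> H wq; have := two_level_q H; have := two_level_U H.
case: H => [symM [UU qq qU] MU muge [Mq F]] MUU Mqq.
pose t := dotv w U; pose w' := w - t *: U.
have w'U : dotv w' U = 0 by rewrite /w' !dotvE UU -/t; ring.
have w'q : dotv w' q = 0 by rewrite /w' !dotvE wq (dotvC U q) qU; ring.
have wE : w = w' + t *: U by rewrite subrK.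
clearbody w'.
have := @frob2_ge3Z _ _ _ M q U w' qq UU qU; rewrite dotvC w'q dotvC w'U.
move=> /(_ erefl erefl); rewrite MUU => B.
have MwU : dotv (M *m w') U = 0.
  by rewrite dotv_mulmxl symM MU dotvZr w'U mulr0.
have -> : dotv w w = dotv w' w' + t ^+ 2.
  by rewrite wE !dotvE (dotvC U w') w'U UU; ring.
have -> : dotv (M *m w) (M *m w) = dotv (M *m w') (M *m w') + t ^+ 2 * mu ^+ 2.
  rewrite wE mulmxDr -scalemxAr MU.
  by rewrite !dotvE (dotvC U (M *m w')) MwU UU; ring.
suff : dotv (M *m w') (M *m w') <= mu ^+ 2 * dotv w' w' by lra.
have D := dotv_ge0 w'.
have : frob2 M * dotv w' w' <= 3 * dotv w' w' by rewrite ler_wpM2r.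
have : (9 / 4 - 3 * eps) * dotv w' w' <= dotv (M *m q) (M *m q) * dotv w' w'.
  by rewrite ler_wpM2r.
have : (5 / 8 - eps) ^+ 2 * dotv w' w' <= mu ^+ 2 * dotv w' w'.
  by rewrite ler_wpM2r // ler_pXn2r // nnegrE; lra.
move: B; nra.
Qed.

Lemma nrm_le_scale m k (x : 'cV[R]_m) (x' : 'cV[R]_k) (c : R) :
  dotv x x <= c ^+ 2 * dotv x' x' -> nrm x <= `|c| * nrm x'.
Proof.
by move=> h; rewrite nrm_le ?mulr_ge0 // exprMn sqr_nrm real_normK ?num_real.
Qed.

Lemma nrm_ge_scale m k (x : 'cV[R]_m) (x' : 'cV[R]_k) (c : R) :
  c ^+ 2 * dotv x' x' <= dotv x x -> `|c| * nrm x' <= nrm x.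
Proof.
by move=> h; rewrite nrm_ge ?mulr_ge0 // exprMn sqr_nrm real_normK ?num_real.
Qed.

(* Weyl's inequality for the second singular value, by min-max on span (q, U). *)
Lemma second_singular_loc M A U q mu l (d : R) : two_level M U q mu ->
  second_singular A l ->
  (forall x : 'cV[R]_n, nrm ((A - M) *m x) <= d * nrm x) ->
  mu - d <= `|l| <= mu + d.
Proof.
move=> H [v1 [v2 [v11 v22 v12 lb ub]]] E.
have Mqq := two_level_q H; have MUU := two_level_U H.
have perp := @two_level_perp _ _ _ _ _ H.
case: H => [symM [UU qq qU] MU muge [Mq F]].
have mu0 : `|mu| = mu by rewrite ger0_norm; lra.
have MA x : nrm (M *m x) <= nrm (A *m x) + d * nrm x.
  have := nrmB (M *m x) (A *m x); rewrite -mulmxBl -(nrmN ((M - A) *m x)) -mulNmx opprB.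
  by have := E x; lra.
have AM x : nrm (A *m x) <= nrm (M *m x) + d * nrm x.
  have := nrmB (A *m x) (M *m x); rewrite -mulmxBl.
  by have := E x; lra.
apply/andP; split.
  have [a [b [ab ab0]]] := lin_dep2 (dotv q v1) (dotv U v1).
  pose w := a *: q + b *: U.
  have wv1 : dotv w v1 = 0 by rewrite /w !dotvE.
  have ww : dotv w w = a ^+ 2 + b ^+ 2.
    by rewrite /w !dotvE (dotvC U q) qq UU qU; ring.
  have wpos : 0 < nrm w by rewrite sqrtr_gt0 ww.
  have /nrm_ge_scale : mu ^+ 2 * dotv w w <= dotv (M *m w) (M *m w).
    have MqU : dotv (M *m q) U = 0 by rewrite dotv_mulmxl symM MU dotvZr qU mulr0.
    rewrite ww /w mulmxDr -!scalemxAr MU !dotvE (dotvC U) MqU UU.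
    have : mu ^+ 2 * a ^+ 2 <= dotv (M *m q) (M *m q) * a ^+ 2.
      by rewrite ler_wpM2r ?sqr_ge0 //; have := two_level_mu (And5 symM (And3 UU qq qU) MU muge (conj Mq F)); nra.
    by move: (dotv (M *m q) (M *m q)) => c; nra.
  have := nrm_le_scale (ub w wv1); have := MA w; rewrite mu0 => h1 h2 h3.
  have : mu * nrm w <= (`|l| + d) * nrm w by lra.
  by rewrite ler_pM2r //; lra.
(* The upper bound exchanges the roles: a vector in the plane of [v1] and [v2], orthogonal to
   [q]. *)
have [a [b [ab ab0]]] := lin_dep2 (dotv v1 q) (dotv v2 q).
pose w := a *: v1 + b *: v2.
have wq : dotv w q = 0 by rewrite /w !dotvE.
have ww : dotv w w = a ^+ 2 + b ^+ 2.
  by rewrite /w !dotvE (dotvC v2 v1) v11 v22 v12; ring.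
have wpos : 0 < nrm w by rewrite sqrtr_gt0 ww.
have := nrm_le_scale (perp w wq); have := AM w.
have := lb a b; rewrite -ww => /nrm_ge_scale; rewrite mu0 => h1 h2 h3.
have : `|l| * nrm w <= (mu + d) * nrm w by lra.
by rewrite ler_pM2r.
Qed.

(** Arithmetic of the splitting q = g + c z, for z with residual h = M z - l z: [a] and [b] are the
    products of h with g and z, [t] is the squared norm of g, and [G] the quadratic form of M at g.
    As |l| is well below 3 / 2, dropping the z part costs the Rayleigh quotient only O(eps). *)
Lemma two_level_gap_arith (c l a b t G : R) : t = 1 - c ^+ 2 -> 0 <= t ->
  `|a| <= eps -> `|b| <= eps -> `|l| <= 9 / 10 ->
  3 / 2 - eps <= G + 2 * (c * a) + c ^+ 2 * (l + b) ->
  (3 / 2 - 5 * eps) * t <= G /\ 5 / 10 <= G.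
Proof.
move=> tE t0 ha hb hl hG.
have c1 : c ^+ 2 <= 1 by lra.
have cabs : `|c| <= 1.
  by rewrite -(@ler_pXn2r _ 2) ?nnegrE // expr1n real_normK ?num_real.
have ca : c * a <= eps.
  apply: le_trans (ler_norm _) _; rewrite normrM.
  by apply: le_trans (ler_wpM2r (normr_ge0 _) cabs) _; rewrite (mul1r `|a|).
have cb : c ^+ 2 * (l + b) <= c ^+ 2 * (9 / 10 + eps).
  rewrite ler_wpM2l ?sqr_ge0 //.
  by move: hb hl; rewrite !ler_norml => /andP[_ ?] /andP[_ ?]; lra.
have := sqr_ge0 c; move: (c ^+ 2) (c * a) tE c1 ca cb hG => c2 ca' tE c1 ca cb hG c20.
split; lra.
Qed.

(** Otherwise the Frobenius budget is overdrawn: [z] consumes about l ^ 2 >= 25 / 64, [U] consumes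
    mu ^ 2, also about 25 / 64 or more, and the part of [q] orthogonal to [z], whose Rayleigh
    quotient is still about 3 / 2, consumes about 9 / 4. The total exceeds 3. *)
Lemma two_level_gap_unit M U q mu l z : two_level M U q mu ->
  5 / 8 - 3 / 2 * eps <= `|l| <= 9 / 10 -> dotv z U = 0 -> dotv z z = 1 ->
  eps <= nrm (M *m z - l *: z).
Proof.
move=> H /andP[l1 l2] zU zz; rewrite leNgt; apply/negP => hlt.
have MUU := two_level_U H.
case: H => [symM [UU qq qU] MU muge [Mq F]].
set h := M *m z - l *: z in hlt.
have MzE : M *m z = l *: z + h by rewrite addrC subrK.
have nz : nrm z = 1 by rewrite /nrm zz sqrtr1.
pose c := dotv q z; pose g := q - c *: z.
have gz : dotv g z = 0 by rewrite /g !dotvE zz -/c; ring.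
have gU : dotv g U = 0 by rewrite /g !dotvE zU qU; ring.
have qE : q = g + c *: z by rewrite subrK.
have tE : dotv g g = 1 - c ^+ 2.
  by rewrite /g !dotvE qq zz (dotvC z q) -/c; ring.
have t0 := dotv_ge0 g.
have ng : nrm g <= 1 by rewrite nrm_le // expr1n tE gerBl sqr_ge0.
clearbody h g; set t := dotv g g in tE t0.
have hz : `|dotv h z| <= eps.
  by apply: le_trans (normr_dotv_le h z) _; rewrite nz mulr1 ltW.
have hg : `|dotv h g| <= eps.
  apply: le_trans (normr_dotv_le h g) _.
  by apply: le_trans (ler_wpM2l (nrm_ge0 _) ng) _; rewrite mulr1 ltW.
have gMz : dotv (M *m g) z = dotv h g.
  by rewrite dotv_mulmxl symM MzE !dotvE gz dotvC; ring.
have [gMg1 gMg2] : (3 / 2 - 5 * eps) * t <= dotv (M *m g) g /\ 5 / 10 <= dotv (M *m g) g.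
  apply: two_level_gap_arith tE t0 hg hz l2 _.
  move: Mq; rewrite {1}qE mulmxDr -scalemxAr [X in dotv _ X]qE.
  rewrite !dotvE gMz MzE !dotvE zz (dotvC z g) gz.
  by move=> hh; apply: (le_trans hh); rewrite le_eqVlt; apply/orP; left; apply/eqP; ring.
have tpos : 0 < t.
  rewrite lt_neqAle t0 andbT eq_sym dotv_eq0; apply/eqP => g0.
  by move: gMg2; rewrite g0 mulmx0 /dotv big1 => [|i _]; rewrite ?mxE ?mul0r; lra.
have Mg : (9 / 4 - 15 * eps) * t <= dotv (M *m g) (M *m g).
  have := dotv_CS (M *m g) g; rewrite -/t => cs.
  rewrite -(ler_pM2r tpos); apply: le_trans cs.
  apply: le_trans (_ : ((3 / 2 - 5 * eps) * t) ^+ 2 <= _); first by clear; nra.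
  rewrite ler_pXn2r // nnegrE; first by rewrite mulr_ge0 //; lra.
  by move: gMg2; clear; lra.
have Mz : 25 / 64 - 4 * eps <= dotv (M *m z) (M *m z).
  have := nrmB (- (l *: z)) h; rewrite nrmN nrmZ nz mulr1 -opprD -MzE nrmN.
  rewrite -sqr_nrm => h1.
  have : 5 / 8 - 5 / 2 * eps <= nrm (M *m z) by move: l1 hlt h1; clear; lra.
  by clear; nra.
have := @frob2_ge3Z _ _ _ M z U g zz UU zU.
rewrite (dotvC z g) gz (dotvC U g) gU MUU -/t => /(_ erefl erefl).
have : (25 / 64 - 2 * eps) * t <= mu ^+ 2 * t by rewrite ler_wpM2r //; move: muge; clear; nra.
have : (25 / 64 - 4 * eps) * t <= dotv (M *m z) (M *m z) * t by rewrite ler_wpM2r.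
have : frob2 M * t <= 3 * t by rewrite ler_wpM2r.
by move: Mg tpos; clear; lra.
Qed.

Lemma two_level_gap M U q mu l z : two_level M U q mu ->
  5 / 8 - 3 / 2 * eps <= `|l| <= 9 / 10 -> dotv z U = 0 ->
  eps * nrm z <= nrm (M *m z - l *: z).
Proof.
move=> H hl zU; have [->|z0] := eqVneq z 0.
  by rewrite (_ : nrm (0 : 'cV[R]_n) = 0) ?mulr0 //; apply/eqP; rewrite nrm_eq0.
have zn : 0 < nrm z by rewrite nrm_gt0.
have := @two_level_gap_unit _ _ _ _ l ((nrm z)^-1 *: z) H hl.
rewrite !dotvE zU mulr0 -sqr_nrm -scalemxAr scalerA (mulrC l) -scalerA -scalerBr nrmZ.
rewrite ger0_norm ?invr_ge0 // => /(_ erefl) h.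
rewrite -ler_pdivlMr // [X in _ <= X]mulrC; apply: h.
by field; rewrite gt_eqF.
Qed.

(** Write y = z + a U. The part of - (A - M) y orthogonal to [U] is (M - l) z, so the gap gives eps
    |z| <= |(A - M) U| + eps / 2 |z|; the last term is absorbed, whence the factor 2 / eps. Finally
    |y - U| ^ 2 = 2 - 2 a <= 2 (1 - a ^ 2) = 2 |z| ^ 2, using 0 <= a <= 1. *)
Lemma second_eigvec_close1 M A U q mu l y : two_level M U q mu ->
  second_singular A l ->
  (forall x : 'cV[R]_n, nrm ((A - M) *m x) <= eps / 2 * nrm x) ->
  A *m y = l *: y -> dotv y y = 1 -> 0 <= dotv y U ->
  dotv (y - U) (y - U) <= 2 * (2 * 10 ^+ 3) ^+ 2 * dotv ((A - M) *m U) ((A - M) *m U).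
Proof.
move=> H ss E Ay yy yU.
have loc := second_singular_loc H ss E.
have mule := two_level_mu H.
have hl : 5 / 8 - 3 / 2 * eps <= `|l| <= 9 / 10.
  by case: (H) => _ _ _ muge _; move: loc => /andP[? ?]; apply/andP; split; lra.
have gap z := @two_level_gap _ _ _ _ l z H hl.
case: H => [symM [UU qq qU] MU muge _].
set a := dotv y U in yU *.
pose z := y - a *: U.
have zU : dotv z U = 0 by rewrite /z !dotvE UU -/a; ring.
have yE : y = z + a *: U by rewrite subrK.
have zz : dotv z z = 1 - a ^+ 2.
  by rewrite /z !dotvE (dotvC U y) yy UU -/a; ring.
have aE : dotv y U = a by [].
clearbody z a.
have hE : (M *m z - l *: z) + (a * (mu - l)) *: U = - ((A - M) *m y).
  rewrite mulmxBl Ay opprB yE mulmxDr -scalemxAr MU scalerDr !scalerA.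
  rewrite mulrBr scalerBl (mulrC l a) -!addrA; congr (_ + _).
  by rewrite opprD addrCA.
have perp : dotv (M *m z - l *: z) U = 0.
  by rewrite !dotvE dotv_mulmxl symM MU !dotvE zU; ring.
have le1 : nrm (M *m z - l *: z) <= nrm ((A - M) *m y).
  rewrite nrm_le // sqr_nrm -[X in _ <= X]opprK -dotvNl -dotvNr -hE.
  move: (M *m z - l *: z) perp => v perp.
  by rewrite !dotvE (dotvC U) perp UU !mulr0 add0r addr0 mulr1 -expr2 lerDl sqr_ge0.
have a1 : a <= 1 by have := dotv_ge0 z; nra.
have le2 : nrm ((A - M) *m y) <= nrm ((A - M) *m U) + eps / 2 * nrm z.
  rewrite yE mulmxDr -scalemxAr addrC; apply: le_trans (nrmD _ _) _.
  rewrite lerD // nrmZ ger0_norm //.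
  by apply: le_trans (ler_wpM2r (nrm_ge0 _) a1) _; rewrite mul1r.
have le3 := gap z zU.
have zle : nrm z <= 2 * 10 ^+ 3 * nrm ((A - M) *m U) by lra.
have zle2 : dotv z z <= (2 * 10 ^+ 3) ^+ 2 * dotv ((A - M) *m U) ((A - M) *m U).
  rewrite -!sqr_nrm; apply: le_trans (_ : (2 * 10 ^+ 3 * nrm ((A - M) *m U)) ^+ 2 <= _).
    by rewrite ler_pXn2r ?nnegrE // mulr_ge0.
  by rewrite exprMn.
have -> : dotv (y - U) (y - U) = 2 - 2 * a.
  by rewrite !dotvE (dotvC U y) yy UU aE; ring.
move: zle2; rewrite zz; nra.
Qed.

End Perturbation.

(** * Taylor bounds for sine and cosine, and a bound on pi *)

Section Trigonometry.
Variable R : realType.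
Implicit Types x y : R.

(** Drives the chain of Taylor bounds below, each of which integrates the preceding one. *)
Lemma derive_ge0_ge0 (f df : R -> R) : (forall t : R, is_derive t (1 : R) f (df t)) ->
  (forall t, 0 <= t -> 0 <= df t) -> f 0 = 0 -> forall x, 0 <= x -> 0 <= f x.
Proof.
move=> fdf df0 f0 x; rewrite le_eqVlt => /orP[/eqP <-|x0]; first by rewrite f0.
have cf : {within `[0, x], continuous f}%classic.
  apply: derivable_within_continuous => t _.
  by have [] := fdf t.
have [c /andP[c0 _]] := MVT x0 (fun t _ => fdf t) cf.
rewrite f0 !subr0 => ->; apply: mulr_ge0 (ltW x0); apply: df0.
by move: c0; rewrite bnd_simp => /ltW.
Qed.

Lemma sin_le x : 0 <= x -> sin x <= x.
Proof.
move=> x0; rewrite -subr_ge0.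
apply: (@derive_ge0_ge0 (fun t => t - sin t) (fun t => 1 - cos t)) => //.
by rewrite sin0 subrr.
Qed.

Lemma cos_ge x : 0 <= x -> 1 - x ^+ 2 / 2 <= cos x.
Proof.
move=> x0; rewrite -subr_ge0.
apply: (@derive_ge0_ge0 (fun t => cos t - (1 - t ^+ 2 / 2)) (fun t => t - sin t)) => //.
- move=> t; apply: is_derive_eq.
  by rewrite /GRing.scale /=; field.
- by move=> t t0; rewrite subr_ge0 sin_le.
- by rewrite cos0; ring.
Qed.

Lemma sin_ge x : 0 <= x -> x - x ^+ 3 / 6 <= sin x.
Proof.
move=> x0; rewrite -subr_ge0.
apply: (@derive_ge0_ge0 (fun t => sin t - (t - t ^+ 3 / 6))
  (fun t => cos t - (1 - t ^+ 2 / 2))) => //.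
- move=> t; apply: is_derive_eq.
  by rewrite /GRing.scale /=; field.
- by move=> t t0; rewrite subr_ge0 cos_ge.
- by rewrite sin0; ring.
Qed.

Lemma cos_le x : 0 <= x -> cos x <= 1 - x ^+ 2 / 2 + x ^+ 4 / 24.
Proof.
move=> x0; rewrite -subr_ge0.
apply: (@derive_ge0_ge0 (fun t => 1 - t ^+ 2 / 2 + t ^+ 4 / 24 - cos t)
  (fun t => sin t - (t - t ^+ 3 / 6))) => //.
- move=> t; apply: is_derive_eq.
  by rewrite /GRing.scale /=; field.
- by move=> t t0; rewrite subr_ge0 sin_ge.
- by rewrite cos0; ring.
Qed.

(** The quartic Taylor bound makes cos (8 / 5) negative, so 8 / 5 lies beyond pi / 2. This is what
    places 2 / pi above 5 / 8. *)
Lemma pi_lt_16_5 : pi < 16 / 5 :> R.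
Proof.
rewrite ltNge; apply/negP => h.
have : 0 <= cos (8 / 5 : R) by apply: cos_ge0_pihalf; apply/andP; split; lra.
have := @cos_le (8 / 5); lra.
Qed.

Lemma sin_ge_half x : 0 <= x <= pi / 2 -> x / 2 <= sin x.
Proof.
move=> /andP[x0 x1]; apply: le_trans (sin_ge x0).
have := pi_lt_16_5 => h.
suff : 0 <= x * (1 / 2 - x ^+ 2 / 6) by lra.
by rewrite mulr_ge0 //; nra.
Qed.

Lemma cosB_prod x y : cos x - cos y = 2 * sin ((x + y) / 2) * sin ((y - x) / 2).
Proof.
have h a b : cos (a - b) - cos (a + b) = 2 * sin a * sin b :> R.
  by rewrite cosB cosD; ring.
rewrite -h; by congr (cos _ - cos _); field.
Qed.

(* The cosine is flat at both ends of [0, pi], hence the quadratic bound. *)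
Lemma cosB_ge x y d : 0 <= d -> 0 <= x -> x + 2 * d <= y -> y <= pi ->
  d ^+ 2 / 2 <= cos x - cos y.
Proof.
move=> d0 x0 xy ypi; rewrite cosB_prod.
have s1 : d / 2 <= sin ((y - x) / 2).
  apply: le_trans (_ : (y - x) / 2 / 2 <= _); first by lra.
  by apply: sin_ge_half; apply/andP; split; lra.
have s2 : d / 2 <= sin ((x + y) / 2).
  have [le|gt] := leP ((x + y) / 2) (pi / 2).
    apply: le_trans (_ : (x + y) / 2 / 2 <= _); first by lra.
    by apply: sin_ge_half; apply/andP; split; lra.
  (* Past pi / 2, the sine is read at the reflected angle pi - t, at least (y - x) / 2 since y <=
     pi. *)
  rewrite -[X in sin X]opprK sinN -(opprK (sin _)) -sinDpi opprK.
  apply: le_trans (_ : (- ((x + y) / 2) + pi) / 2 <= _); first by lra.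
  by apply: sin_ge_half; apply/andP; split; lra.
nra.
Qed.

End Trigonometry.

(** * Spectral data of the expected band matrix *)

Section Band.
Variable R : realType.
Variables (p : R) (s : nat).
Hypothesis s0 : (0 < s)%N.

Lemma band_ndist (i j : nat) :
  (0 < ndist i j <= s.-1)%N = (i != j) && ((i < j + s) && (j < i + s))%N.
Proof. by rewrite /ndist; lia. Qed.

Lemma Mexp_sym : (Mexp p s)^T = Mexp p s.
Proof. by apply/matrixP => i j; rewrite !mxE /ndist maxnC minnC. Qed.

(** The band of a row is one interval of columns, clipped below by truncated subtraction and above
    by [minn]; sums over it can then telescope. *)
Lemma sum_band (f : nat -> R) (i : nat) : (i < s.*2)%N ->
  \sum_(j < s.*2 | ((i < j + s) && (j < i + s))%N) f j =
  \sum_((i.+1 - s)%N <= j < minn (i + s)%N s.*2) f j.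
Proof.
move=> i2; rewrite -(big_mkord (fun j => (i < j + s) && (j < i + s))%N f).
rewrite [RHS](@big_nat_widen _ _ _ _ _ s.*2) ?geq_minr //.
rewrite [RHS](@big_nat_widenl _ _ _ _ 0) //.
rewrite big_nat_cond [RHS]big_nat_cond; apply: eq_bigl => j /=; lia.
Qed.

Lemma Mexp_row (f : nat -> R) (i : 'I_(s.*2)) :
  \sum_j Mexp p s i j * f j =
  p * (\sum_((i.+1 - s)%N <= j < minn (i + s)%N s.*2) f j - f i).
Proof.
rewrite -sum_band // [X in p * (X - _)](bigD1 i) /=; last by lia.
rewrite [X in p * X]addrAC subrr add0r mulr_sumr [RHS]big_mkcond /=.
apply: eq_bigr => j _; rewrite mxE band_ndist val_eqE.
have [_|ij] := eqVneq i j; first by rewrite /= andbF mul0r.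
by rewrite /= andbT; case: ifP => _; rewrite ?mul0r.
Qed.

Lemma Mexp_sum : \sum_i \sum_j Mexp p s i j = p * (3 * s%:R * (s%:R - 1)).
Proof.
have -> : \sum_i \sum_j Mexp p s i j =
    \sum_(i < s.*2) p * ((minn (i + s) s.*2 - (i.+1 - s))%N%:R - 1).
  apply: eq_bigr => i _.
  under eq_bigr => j _ do rewrite -[Mexp p s i j]mulr1.
  by rewrite (Mexp_row (fun=> 1)) big_const_nat iter_addr addr0.
rewrite -mulr_sumr; congr (_ * _).
rewrite -(big_mkord xpredT (fun i => (minn (i + s) s.*2 - (i.+1 - s))%N%:R - 1)).
rewrite (@big_cat_nat _ _ _ s) //=; last by lia.
(* Rows i and i + s are paired: their intervals have s + i and 2 s - i - 1 columns, so each pair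
   contributes 3 (s - 1) once the two diagonal entries are removed. *)
rewrite (_ : \sum_(s <= i < s.*2) _ =
   \sum_(0 <= i < s) ((minn (i + s + s) s.*2 - ((i + s).+1 - s))%N%:R - 1)).
  2:{ by rewrite -{1}(add0n s) big_addn -addnn addnK. }
rewrite -big_split /= (@eq_big_nat _ _ _ _ _ _ (fun=> 3 * (s%:R - 1))).
  by rewrite big_const_nat iter_addr addr0 subn0 -mulr_natl; ring.
move=> i /andP[_ is_].
rewrite (_ : (minn (i + s) s.*2 - (i.+1 - s))%N = (i + s)%N); last by lia.
rewrite (_ : (minn (i + s + s) s.*2 - ((i + s).+1 - s))%N = (s + s - i.+1)%N); last by lia.
by rewrite natrB; [rewrite !natrD -natr1; ring | lia].
Qed.

Lemma frob2_Mexp : frob2 (Mexp p s) = p ^+ 2 * (3 * s%:R * (s%:R - 1)).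
Proof.
rewrite expr2 -mulrA -Mexp_sum mulr_sumr; apply: eq_bigr => i _.
rewrite mulr_sumr; apply: eq_bigr => j _; rewrite !mxE.
by case: ifP => _; rewrite ?expr2 ?mulr0.
Qed.

Definition theta : R := pi / (4 * s%:R + 2).

(** Since - cos t = cos (pi - t), both halves of u become the cosine of one increasing phase. Its
    step is 2 theta, doubled at the middle. *)
Definition phase (j : nat) : R :=
  if (j < s)%N then (2 * j%:R + 1) * theta else (2 * j%:R + 3) * theta.

Let sR1 : 1 <= s%:R :> R. Proof. by rewrite ler1n. Qed.
Let den0 : 4 * s%:R + 2 != 0 :> R. Proof. by rewrite gt_eqF //; lra. Qed.

Lemma theta_pi : (4 * s%:R + 2) * theta = pi.
Proof. by rewrite /theta; field; rewrite mulrC. Qed.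

Lemma theta_gt0 : 0 < theta.
Proof. by rewrite divr_gt0 ?pi_gt0 //; lra. Qed.

Lemma uvecE (j : 'I_(s.*2)) : uvec R s j 0 = cos (phase j).
Proof.
rewrite mxE /phase; case: ifP => js.
  by rewrite -mulrA.
rewrite -mulrA -/theta.
have -> : (s.*2 - 1 - j)%N%:R = 2 * s%:R - 1 - j%:R :> R.
  have := ltn_ord j; move: (nat_of_ord j) => k kl; rewrite -subnDA natrB; last by lia.
  by rewrite -mul2n natrM natrD; ring.
rewrite (_ : (2 * j%:R + 3) * theta =
   - ((2 * (2 * s%:R - 1 - j%:R) + 1) * theta) + pi); last by rewrite -theta_pi; ring.
by rewrite cosDpi cosN.
Qed.

Lemma phase_ge0 j : theta <= phase j.
Proof.
rewrite /phase; have th := theta_gt0; have j0 : 0 <= j%:R :> R by [].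
by case: ifP => _; nra.
Qed.

Lemma phase_le j : (j < s.*2)%N -> phase j <= pi - theta.
Proof.
move=> js; rewrite -theta_pi /phase; have th := ltW theta_gt0.
rewrite -[X in _ - X]mul1r -mulrBl; case: ifP => j1; rewrite ler_wpM2r //.
  by have : j%:R + 1 <= s%:R :> R; [rewrite natr1 ler_nat | have := sR1; lra].
by have : j%:R + 1 <= 2 * s%:R :> R; [rewrite natr1 -natrM ler_nat mul2n | lra].
Qed.

Lemma phase_gap i j k : i%:R + k <= j%:R -> 0 <= k ->
  phase i + 2 * (k * theta) <= phase j.
Proof.
move=> ij k0; have th := theta_gt0.
have ijn : (i <= j)%N by rewrite -(ler_nat R); lra.
rewrite /phase; case: ifP => hi; case: ifP => hj; try nra.
by lia.
Qed.

Definition antid (j : nat) : R :=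
  if (j <= s)%N then sin (2 * j%:R * theta) else sin (2 * (j%:R + 1) * theta).

Lemma theta_half : (2 * s%:R + 1) * theta = pi / 2.
Proof. by rewrite -theta_pi; field. Qed.

(** The two branches agree at j = s, where their angles are pi / 2 - theta and pi / 2 + theta. *)
Lemma antid_ge j : (s <= j)%N -> antid j = sin (2 * (j%:R + 1) * theta).
Proof.
rewrite /antid => sj; case: ifP => // js.
have -> : j = s by lia.
rewrite (_ : 2 * s%:R * theta = - theta + pi / 2); last by rewrite -theta_half; ring.
rewrite (_ : 2 * (s%:R + 1) * theta = theta + pi / 2); last by rewrite -theta_half; ring.
by rewrite !sinDpihalf cosN.
Qed.

Lemma sinB_prod (x y : R) : sin (x + y) - sin (x - y) = 2 * sin y * cos x.
Proof. by rewrite sinB sinD; ring. Qed.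

(* [antid] is a discrete primitive of the eigenvector. *)
Lemma antid_diff j : antid j.+1 - antid j = 2 * sin theta * cos (phase j).
Proof.
rewrite -sinB_prod /phase; case: ltnP => js.
  rewrite /antid js (ltnW js) -natr1.
  by congr (sin _ - sin _); ring.
rewrite !antid_ge ?(leqW js) // -natr1.
by congr (sin _ - sin _); ring.
Qed.

Lemma sin_theta_gt0 : 0 < sin theta.
Proof.
rewrite sin_gt0_pi // theta_gt0 /= -theta_pi.
by have := mulr_ge0 (ler0n R s) (ltW theta_gt0); have := theta_gt0; lra.
Qed.

(** One end of the band is clipped, and there [antid] is sin 0 or sin pi; the other end is a quarter
    turn, (2 s + 1) theta = pi / 2, away from the phase of i, so its sine is the cosine at i. This
    reproduction of the cosine makes u an eigenvector. *)
Lemma antid_band i : (i < s.*2)%N ->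
  antid (minn (i + s) s.*2) - antid (i.+1 - s) = cos (phase i).
Proof.
move=> i2; rewrite /phase; case: ltnP => js.
  rewrite (_ : minn _ _ = i + s)%N; last by lia.
  rewrite (_ : i.+1 - s = 0)%N; last by lia.
  rewrite antid_ge ?leq_addl // /antid leq0n mulr0 mul0r sin0 subr0.
  rewrite -sinDpihalf -theta_half natrD; congr sin; ring.
rewrite (_ : minn _ _ = s.*2)%N; last by lia.
rewrite antid_ge; last by lia.
rewrite {1}/antid (_ : (i.+1 - s <= s)%N = true); last by lia.
rewrite (_ : 2 * (s.*2%:R + 1) * theta = pi); last first.
  by rewrite -theta_pi -mul2n natrM; ring.
rewrite sinpi sub0r -cosDpihalf -theta_half natrB ?leqW // -natr1.
by congr cos; ring.
Qed.

(** The inverse of 2 sin theta comes from telescoping, the - 1 from the zero diagonal. *)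
Definition mu2 : R := p * ((2 * sin theta)^-1 - 1).

Lemma Mexp_uvec : Mexp p s *m uvec R s = mu2 *: uvec R s.
Proof.
apply/colP => i; rewrite [LHS]mxE [RHS]mxE uvecE.
under eq_bigr => j _ do rewrite uvecE.
rewrite (Mexp_row (cos \o phase)) /mu2 -mulrA mulrBl mul1r; congr (_ * (_ - _)).
have st := sin_theta_gt0.
rewrite -[in RHS]antid_band ?ltn_ord // mulrC.
rewrite -telescope_sumr; last by have := ltn_ord i; lia.
rewrite mulr_suml; apply: eq_bigr => j _.
by rewrite antid_diff /=; field; rewrite gt_eqF.
Qed.

Lemma uvec_opp (i : 'I_(s.*2)) : uvec R s (rev_ord i) 0 = - uvec R s i 0.
Proof.
rewrite !mxE /=; have := ltn_ord i; case: (i) => k /= kl _.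
have -> : (s.*2 - k.+1 < s)%N = ~~ (k < s)%N by lia.
case: (ltnP k s) => ks /=.
  2: by rewrite opprK (_ : (s.*2 - 1 - k = s.*2 - k.+1)%N) //; lia.
by rewrite (_ : (s.*2 - 1 - (s.*2 - k.+1))%N = k) //; lia.
Qed.

Lemma sum_uvec : \sum_i uvec R s i 0 = 0.
Proof.
have h : \sum_i uvec R s i 0 = - \sum_i uvec R s i 0.
  rewrite {1}(reindex_inj rev_ord_inj) /= -sumrN.
  by apply: eq_bigr => i _; rewrite uvec_opp.
lra.
Qed.

Lemma uvec_norm_le : dotv (uvec R s) (uvec R s) <= 2 * s%:R.
Proof.
rewrite -natrM mul2n -[X in _ <= X%:R]card_ord -sum1_card natr_sum.
apply: ler_sum => i _; rewrite uvecE -expr2.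
by rewrite cos2sin2 gerBl sqr_ge0.
Qed.

Lemma uvec_neq0 : uvec R s != 0.
Proof.
have l0 : (0 < s.*2)%N by lia.
apply/eqP => /matrixP/(_ (Ordinal l0) 0); rewrite mxE /= s0 mulr0 add0r mul1r mxE.
rewrite -/theta; apply/eqP; rewrite gt_eqF // cos_gt0_pihalf // -theta_half.
by have := mulr_gt0 (lt_le_trans ltr01 sR1) theta_gt0; have := theta_gt0 => *; apply/andP; split; lra.
Qed.

Lemma uvec_gap (i j : 'I_(s.*2)) (k : R) : 0 <= k -> i%:R + k <= j%:R ->
  (k * theta) ^+ 2 / 2 <= uvec R s i 0 - uvec R s j 0.
Proof.
move=> k0 ijk; rewrite !uvecE; have th := theta_gt0.
apply: cosB_ge.
- by rewrite mulr_ge0 // ltW.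
- exact: le_trans (ltW th) (phase_ge0 _).
- exact: phase_gap.
- by apply: le_trans (phase_le (ltn_ord j)) _; lra.
Qed.

End Band.

(** * Rescaling of the band matrix to the two-level profile *)

Section Normalised.
Variable R : realType.

Definition unitv n (x : 'cV[R]_n) := (nrm x)^-1 *: x.

Lemma dotv_unitv n (x : 'cV[R]_n) : x != 0 -> dotv (unitv x) (unitv x) = 1.
Proof.
move=> x0; rewrite /unitv !dotvE -sqr_nrm; field.
by rewrite nrm_eq0.
Qed.

Lemma second_singularZ n (A : 'M[R]_n) l c :
  second_singular A l -> second_singular (c *: A) (c * l).
Proof.
move=> [v1 [v2 [v11 v22 v12 lb ub]]]; exists v1, v2; split=> //.
  move=> a b; rewrite -scalemxAl dotvZl dotvZr mulrA -expr2 exprMn.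
  by rewrite -(mulrA (c ^+ 2)) ler_wpM2l ?sqr_ge0.
move=> w w1; rewrite -scalemxAl dotvZl dotvZr mulrA -expr2 exprMn.
by rewrite -(mulrA (c ^+ 2)) ler_wpM2l ?sqr_ge0 ?ub.
Qed.

Lemma Mexp_two_level (p : R) s : 0 < p -> 2 * 10 ^+ 3 <= s%:R :> R ->
  two_level ((p * s%:R)^-1 *: Mexp p s) (unitv (uvec R s))
    (unitv (const_mx 1)) ((p * s%:R)^-1 * mu2 p s).
Proof.
move=> p0 sL.
have sR : 0 < s%:R :> R by lra.
have s0 : (0 < s)%N by rewrite -(ltr0n R).
have T0 : 0 < p * s%:R by rewrite mulr_gt0.
have T1 : p * s%:R != 0 by rewrite gt_eqF.
set one : 'cV[R]_(s.*2) := const_mx 1.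
have oneone : dotv one one = 2 * s%:R.
  rewrite /dotv; under eq_bigr do rewrite !mxE mulr1.
  by rewrite sumr_const card_ord -mul2n natrM.
have none : nrm one ^+ 2 = 2 * s%:R by rewrite sqr_nrm.
have one0 : one != 0 by rewrite -dotv_eq0 oneone mulf_neq0 // ?gt_eqF.
split.
- by rewrite linearZ /= Mexp_sym.
- split; [exact: dotv_unitv (uvec_neq0 R s0) | exact: dotv_unitv |].
  rewrite /unitv !dotvE (_ : dotv one _ = 0) ?mulr0 //.
  rewrite -[RHS](sum_uvec R s0); apply: eq_bigr => i _.
  by rewrite /one mxE mul1r.
- by rewrite /unitv -scalemxAr -scalemxAl Mexp_uvec // !scalerA; congr (_ *: _); ring.
- have st := sin_theta_gt0 R s.
  (* From 2 sin theta <= 2 theta = pi / (2 s + 1) and pi < 16 / 5. *)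
  have : (2 * s%:R + 1) * (5 / 16) <= (2 * sin (theta R s))^-1.
    rewrite -[X in X <= _]invrK lef_pV2 ?posrE ?mulr_gt0 ?invr_gt0 //; try lra.
    have le1 := sin_le (ltW (theta_gt0 R s)).
    apply: le_trans (_ : 2 * theta R s <= _); first by lra.
    rewrite invfM ler_pdivlMl; last by lra.
    have := theta_half R s; have := pi_lt_16_5 R; move: (theta R s) => t h1 h2.
    rewrite mulrCA h2; move: h1; lra.
  rewrite /mu2; set X := (2 * sin _)^-1 => hX.
  have -> : (p * s%:R)^-1 * (p * (X - 1)) = (X - 1) / s%:R.
    by field; rewrite ?gt_eqF.
  rewrite ler_pdivlMr //; lra.
- have sinv : s%:R^-1 <= (1 / 10) ^+ 3 / 2 :> R.
    by rewrite -(ler_pM2r sR) mulVf ?gt_eqF //; lra.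
  split.
    rewrite /unitv -scalemxAr -scalemxAl !dotvE.
    have -> : dotv (Mexp p s *m one) one = p * (3 * s%:R * (s%:R - 1)).
      rewrite -Mexp_sum //; apply: eq_bigr => i _.
      rewrite !mxE mulr1; apply: eq_bigr => j _.
      by rewrite /one [X in _ * X]mxE mulr1.
    have none0 : nrm one != 0 by rewrite nrm_eq0.
    move: (nrm one) none none0 => N none none0.
    rewrite [X in _ <= X](_ : _ = (p * s%:R)^-1 * ((N ^+ 2)^-1 * (p * (3 * s%:R * (s%:R - 1)))));
      last by field; rewrite none0 !gt_eqF.
    rewrite none [X in _ <= X](_ : _ = 3 / 2 * (1 - s%:R^-1)); first by lra.
    by field; rewrite ?gt_eqF.
  have -> : frob2 ((p * s%:R)^-1 *: Mexp p s) = (p * s%:R)^-1 ^+ 2 * frob2 (Mexp p s).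
    rewrite /frob2 mulr_sumr; apply: eq_bigr => i _.
    by rewrite mulr_sumr; apply: eq_bigr => j _; rewrite !mxE exprMn.
  rewrite frob2_Mexp // (_ : _ * _ = 3 - 3 * s%:R^-1).
    by rewrite gerBl mulr_ge0 // invr_ge0.
  by field; rewrite ?gt_eqF.
Qed.

(* The Davis-Kahan bound with the error measured on the limiting eigenvector. *)
Lemma second_eigvec_close (p : R) s (A : 'M[R]_(s.*2)) l y :
  0 < p -> 2 * 10 ^+ 3 <= s%:R :> R -> A^T = A -> is_lambda2 A l ->
  (forall x : 'cV[R]_(s.*2),
     nrm ((A - Mexp p s) *m x) <= (1 / 10) ^+ 3 / 2 * (p * s%:R) * nrm x) ->
  A *m y = l *: y -> dotv y y = 1 -> 0 <= dotv y (uvec R s) ->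
  let U := unitv (uvec R s) in
  dotv (y - U) (y - U) <=
  2 * (2 * 10 ^+ 3) ^+ 2 / (p * s%:R) ^+ 2 *
    dotv ((A - Mexp p s) *m U) ((A - Mexp p s) *m U).
Proof.
move=> p0 sL symA lam E Ay yy yu; set U := unitv _; cbv zeta.
have sR : 0 < s%:R :> R by lra.
have s0 : (0 < s)%N by rewrite -(ltr0n R).
have T0 : 0 < p * s%:R by rewrite mulr_gt0.
have ss := is_lambda2_second_singular symA _ lam.
have := second_eigvec_close1 (Mexp_two_level p0 sL)
  (second_singularZ (p * s%:R)^-1 (ss _)) (y := y).
rewrite -!scalerBr -!scalemxAl (dotvZl _ (_ *m unitv _)) (dotvZr _ (_ *m unitv _)) (dotvZr _ y).
have -> : forall k, (p * s%:R)^-1 * ((p * s%:R)^-1 * k) = k / (p * s%:R) ^+ 2.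
  by move=> k; field; rewrite ?gt_eqF.
move=> h; rewrite mulrAC -[X in _ <= X]mulrA; apply: h.
- by lia.
- move=> x; rewrite -scalemxAl nrmZ ger0_norm ?invr_ge0 ?(ltW T0) //.
  by rewrite ler_pdivrMl // mulrA (mulrC (p * _)).
- by rewrite Ay scalerA.
- by [].
- by rewrite mulr_ge0 // invr_ge0.
Qed.

End Normalised.

(** * Exponential moment of a centred Bernoulli variable *)

Section Exponential.
Variable R : realType.

Lemma expR_le_quadratic (x : R) : x <= 1 / 2 -> expR x <= 1 + x + 2 * x ^+ 2.
Proof.
move=> x1; have x0 : 0 < 1 - x by lra.
apply: le_trans (_ : (1 - x)^-1 <= _).
  rewrite -[X in X <= _]invrK -expRN lef_pV2 ?posrE ?expR_gt0 //.
  by have := expR_ge1Dx (- x).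
rewrite -[X in X <= _]mul1r ler_pdivrMr //.
have : 0 <= x ^+ 2 * (1 - 2 * x) by rewrite mulr_ge0 ?sqr_ge0 //; lra.
by lra.
Qed.

(** For |a| <= 1 / 2 use the quadratic bound on the exponential, whose linear terms cancel by
    centring; for larger |a| the exponent is at most |a| <= 2 a ^ 2. *)
Lemma bernoulli_mgf (q a : R) : 0 <= q <= 1 ->
  q * expR (a * (1 - q)) + (1 - q) * expR (a * - q) <= expR (2 * a ^+ 2).
Proof.
move=> /andP[q0 q1].
have [small|large] := leP `|a| (1 / 2).
  have [a1 a2] : a <= 1 / 2 /\ - a <= 1 / 2.
    by move: small; rewrite ler_norml => /andP[? ?]; split; lra.
  have h1 : a * (1 - q) <= 1 / 2 by nra.
  have h2 : a * - q <= 1 / 2 by nra.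
  have e1 := ler_wpM2l q0 (expR_le_quadratic h1).
  have q1' : 0 <= 1 - q by lra.
  have e2 := ler_wpM2l q1' (expR_le_quadratic h2).
  apply: le_trans (lerD e1 e2) _; apply: le_trans (expR_ge1Dx _).
  have : 0 <= a ^+ 2 * (1 - q * (1 - q)).
    by rewrite mulr_ge0 ?sqr_ge0 //; nra.
  by lra.
have aa : `|a| <= 2 * a ^+ 2 by rewrite -(@real_normK _ a) ?num_real //; nra.
have h c : `|c| <= 1 -> expR (a * c) <= expR (2 * a ^+ 2).
  move=> c1; rewrite ler_expR; apply: le_trans aa; apply: le_trans (ler_norm _) _.
  by rewrite normrM ler_piMr.
have c1 : `|1 - q| <= 1 by rewrite ger0_norm; lra.
have c2 : `|- q| <= 1 by rewrite normrN ger0_norm; lra.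
have q1' : 0 <= 1 - q by lra.
have := lerD (ler_wpM2l q0 (h _ c1)) (ler_wpM2l q1' (h _ c2)).
by lra.
Qed.

End Exponential.

(** * Finite expectations and moments of the noise matrix *)

Section Probability.
Variables (R : realType) (p : R) (s : nat).
Hypothesis p01 : 0 <= p <= 1.
Local Notation n := (s.*2).
Local Notation I := ('I_(s.*2) * 'I_(s.*2))%type.
Local Notation Omega := {ffun 'I_(s.*2) * 'I_(s.*2) -> bool}.

Let prob (e : I) := if (e.1 < e.2)%N then Mexp p s e.1 e.2 else 0.

Lemma Mexp01 i j : 0 <= Mexp p s i j <= 1.
Proof.
rewrite mxE; case: ifP => _ //; by rewrite lexx ler01.
Qed.

Lemma prob01 e : 0 <= prob e <= 1.
Proof. by rewrite /prob; case: ifP => _; rewrite ?Mexp01 // lexx ler01. Qed.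

Lemma bern_ge0 (q : R) b : 0 <= q <= 1 -> 0 <= bern q b.
Proof. by move=> /andP[q0 q1]; case: b => //=; lra. Qed.

Lemma weight_ge0 (w : Omega) : 0 <= weight p w.
Proof. by apply: prodr_ge0 => e _; apply: bern_ge0; exact: prob01. Qed.

Definition expect (F : Omega -> R) := \sum_w weight p w * F w.

(** Independence: the weight is itself a product over coordinates, so the sum over all outcomes
    distributes. *)
Lemma expect_prod (g : I -> bool -> R) :
  expect (fun w => \prod_e g e (w e)) =
  \prod_e (prob e * g e true + (1 - prob e) * g e false).
Proof.
transitivity (\prod_e \sum_b (bern (prob e) b * g e b)).
  rewrite bigA_distr_bigA; apply: eq_bigr => w _.
  by rewrite /weight -big_split.
by apply: eq_bigr => e _; rewrite big_bool.
Qed.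

Lemma expect1 : expect (fun=> 1) = 1.
Proof.
have := expect_prod (fun _ _ => 1).
rewrite [RHS]big1 => [h|e _]; last by rewrite !mulr1 subrKC.
by rewrite -[RHS]h; apply: eq_bigr => w _; rewrite big1.
Qed.

Lemma le_expect F G : (forall w, F w <= G w) -> expect F <= expect G.
Proof. by move=> FG; apply: ler_sum => w _; rewrite ler_wpM2l ?weight_ge0. Qed.

Lemma expect_sum (T : finType) (P : pred T) (F : T -> Omega -> R) :
  expect (fun w => \sum_(t | P t) F t w) = \sum_(t | P t) expect (F t).
Proof.
by rewrite exchange_big; apply: eq_bigr => w _; rewrite mulr_sumr.
Qed.

Lemma expectZ c F : expect (fun w => c * F w) = c * expect F.
Proof. by rewrite /expect mulr_sumr; apply: eq_bigr => w _; rewrite mulrCA. Qed.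

Lemma Prob_compl (E : Omega -> Prop) : 1 - Prob p (fun w => ~ E w) <= Prob p E.
Proof.
rewrite lerBlDr -expect1 /expect (bigID (fun w => `[< E w >])) /=.
apply: lerD.
  by apply: ler_sum => w _; rewrite mulr1.
rewrite /Prob [X in X <= _](eq_bigl (fun w => `[< ~ E w >])); last first.
  by move=> w; rewrite asbool_neg.
by apply: ler_sum => w _; rewrite mulr1.
Qed.

Lemma le_Prob (E F : Omega -> Prop) : (forall w, E w -> F w) -> Prob p E <= Prob p F.
Proof.
move=> EF; rewrite /Prob [X in _ <= X](bigID (fun w => `[< E w >])) /=.
rewrite [X in X <= _](eq_bigl (fun w => `[< F w >] && `[< E w >])).
  by rewrite lerDl sumr_ge0 // => w _; apply: weight_ge0.
move=> w; apply/idP/idP => [/asboolP Ew|/andP[] //].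
by apply/andP; split; apply/asboolP => //; apply: EF.
Qed.

Lemma Prob_le_expect (E : Omega -> Prop) (F : Omega -> R) :
  (forall w, 0 <= F w) -> (forall w, E w -> 1 <= F w) -> Prob p E <= expect F.
Proof.
move=> F0 EF; rewrite /expect (bigID (fun w => `[< E w >])) /=.
apply: le_trans (_ : \sum_(w | `[< E w >]) weight p w * F w <= _).
  apply: ler_sum => w /asboolP Ew; rewrite -[X in X <= _]mulr1.
  by rewrite ler_wpM2l ?weight_ge0 ?EF.
by rewrite lerDl sumr_ge0 // => w _; rewrite mulr_ge0 ?weight_ge0.
Qed.

Lemma Prob_or (E F : Omega -> Prop) :
  Prob p (fun w => E w \/ F w) <= Prob p E + Prob p F.
Proof.
have ind (A : Omega -> Prop) : Prob p A = expect (fun w => (`[< A w >])%:R).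
  rewrite /Prob big_mkcond; apply: eq_bigr => w _.
  by case: asboolP; rewrite ?mulr1 ?mulr0.
rewrite !ind /expect -big_split /=; apply: ler_sum => w _.
rewrite -mulrDr ler_wpM2l ?weight_ge0 // -natrD ler_nat.
by case: asboolP => // -[] h; rewrite (asboolT h) ?leq_addl ?leq_addr.
Qed.

Definition noise (w : Omega) : 'M[R]_n := Mhat R w - Mexp p s.

Lemma noise_sym w i j : noise w i j = noise w j i.
Proof.
rewrite !mxE /ndist maxnC minnC.
by case: (ltngtP i j) => // /val_inj ->.
Qed.

Lemma noise_diag w i : noise w i i = 0.
Proof. by rewrite !mxE ltnn /ndist maxnn minnn subnn subr0. Qed.

Lemma noise_lt w (i j : 'I_n) : (i < j)%N -> noise w i j = (w (i, j))%:R - prob (i, j).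
Proof. by move=> ij; rewrite 2![in LHS]mxE /prob /= ij [X in _ + X]mxE. Qed.

Lemma noise_le1 w i j : `|noise w i j| <= 1.
Proof.
rewrite 2!mxE [X in _ + X]mxE; have := Mexp01 i j.
set m := Mexp p s i j => /andP[m0 m1]; case: ifP => _.
  by rewrite ler_norml; case: (w _) => /=; apply/andP; split; lra.
case: ifP => _; first by rewrite ler_norml; case: (w _) => /=; apply/andP; split; lra.
by rewrite ler_norml; apply/andP; split; lra.
Qed.

Lemma frob2_noise w : frob2 (noise w) <= n%:R ^+ 2.
Proof.
rewrite /frob2; apply: le_trans (_ : \sum_(i < n) \sum_(j < n) 1 <= _).
  apply: ler_sum => i _; apply: ler_sum => j _.
  by rewrite -real_normK ?num_real // expr_le1 // noise_le1.
by under eq_bigr do rewrite sumr_const card_ord; rewrite sumr_const card_ord -mulrnA mulnn natrX.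
Qed.

(** A crude bound valid for every outcome; it pays for replacing vectors by grid points. *)
Lemma nrm_noise w (x : 'cV[R]_n) : nrm (noise w *m x) <= n%:R * nrm x.
Proof.
rewrite nrm_le ?mulr_ge0 // exprMn sqr_nrm.
apply: le_trans (frob2_ge _ _) _.
by rewrite ler_wpM2r // frob2_noise.
Qed.

(** Folding the entries (i, j) and (j, i) together expresses the form through independent bits
    only. *)
Lemma noise_form w (x z : 'cV[R]_n) :
  dotv z (noise w *m x) = \sum_(e : I)
    (if (e.1 < e.2)%N then
      (z e.1 0 * x e.2 0 + z e.2 0 * x e.1 0) * ((w e)%:R - prob e) else 0).
Proof.
transitivity (\sum_i \sum_j z i 0 * (noise w i j * x j 0)).
  by apply: eq_bigr => i _; rewrite mxE mulr_sumr.
transitivity (\sum_(i < n) \sum_(j < n) ((if (i < j)%N then z i 0 * (noise w i j * x j 0) else 0)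
   + (if (j < i)%N then z i 0 * (noise w i j * x j 0) else 0))).
  apply: eq_bigr => i _; apply: eq_bigr => j _.
  case: (ltngtP i j) => [||/val_inj ->]; rewrite ?addr0 ?add0r //.
  by rewrite noise_diag mul0r mulr0.
under eq_bigr do rewrite big_split.
rewrite big_split /= [X in _ + X]exchange_big /= -big_split /=.
under eq_bigr do rewrite -big_split.
rewrite pair_big; apply: eq_bigr => -[i j] _ /=.
case: ifP => ij; last by rewrite addr0.
by rewrite (noise_sym w j i) noise_lt //; ring.
Qed.

(** Multiply the Bernoulli bounds over pairs i < j; the coefficient of a pair satisfies 2 (z_i x_j +
    z_j x_i) ^ 2 <= 4 (z_i ^ 2 x_j ^ 2 + z_j ^ 2 x_i ^ 2). The vectors are left unnormalised so that
    scaling [z] supplies the Chernoff parameter. *)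
Lemma noise_mgf (x z : 'cV[R]_n) :
  expect (fun w => expR (dotv z (noise w *m x))) <=
  expR (4 * (dotv x x * dotv z z)).
Proof.
pose a (e : I) := z e.1 0 * x e.2 0 + z e.2 0 * x e.1 0.
pose g (e : I) (b : bool) : R :=
  if (e.1 < e.2)%N then expR (a e * (b%:R - prob e)) else 1.
have -> : expect (fun w => expR (dotv z (noise w *m x))) =
    expect (fun w => \prod_e g e (w e)).
  apply: eq_bigr => w _; congr (_ * _); rewrite noise_form expR_sum.
  by apply: eq_bigr => e _; rewrite /g; case: ifP => _ //; rewrite expR0.
rewrite expect_prod.
pose h (e : I) := z e.1 0 ^+ 2 * x e.2 0 ^+ 2.
apply: (@le_trans _ _ (\prod_(e : I) expR (if (e.1 < e.2)%N then 2 * a e ^+ 2 else 0))).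
  apply: ler_prod => e _; rewrite /g; have pe := prob01 e.
  case: ifP => _; last by rewrite expR0 !mulr1 subrKC lexx ler01.
  have := bernoulli_mgf (a e) pe; rewrite sub0r => -> /=; rewrite andbT.
  by move: pe => /andP[? ?]; rewrite addr_ge0 // mulr_ge0 ?expR_ge0 // subr_ge0.
rewrite -expR_sum ler_expR.
apply: le_trans (_ : \sum_(e : I)
    (if (e.1 < e.2)%N then 4 * (h e + h (e.2, e.1)) else 0) <= _).
  apply: ler_sum => e _; case: ifP => _ //; rewrite /a /h /=.
  have := sqr_ge0 (z e.1 0 * x e.2 0 - z e.2 0 * x e.1 0).
  by move: (z e.1 0) (x e.2 0) (z e.2 0) (x e.1 0) => *; lra.
have -> : dotv x x * dotv z z = \sum_(i < n) \sum_(j < n) h (i, j).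
  rewrite mulrC mulr_suml; apply: eq_bigr => i _; rewrite mulr_sumr.
  by apply: eq_bigr => j _; rewrite /h -!expr2.
rewrite -(pair_bigA _ (fun i j : 'I_n =>
   if (i < j)%N then 4 * (h (i, j) + h (j, i)) else 0)) /=.
have -> : \sum_(i < n) \sum_(j < n)
      (if (i < j)%N then 4 * (h (i, j) + h (j, i)) else 0) =
    \sum_(i < n) \sum_(j < n) (if (i < j)%N then 4 * h (i, j) else 0) +
    \sum_(i < n) \sum_(j < n) (if (i < j)%N then 4 * h (j, i) else 0).
  rewrite -big_split; apply: eq_bigr => i _; rewrite -big_split.
  by apply: eq_bigr => j _ /=; case: ifP => _; rewrite ?addr0 // mulrDr.
rewrite [X in _ + X]exchange_big /= -big_split /=.
rewrite mulr_sumr; apply: ler_sum => i _; rewrite -big_split mulr_sumr.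
apply: ler_sum => j _ /=; have : 0 <= h (i, j) by rewrite mulr_ge0 ?sqr_ge0.
by case: ltngtP; lra.
Qed.

End Probability.

(** * Rounding of vectors to finite grids *)

Section Grid.
Variables (R : realType) (n : nat).

(* The integer k or -k, encoded as a sign and an absolute value. *)
Definition gridv (t : bool * 'I_n.+1) : R := (-1) ^+ t.1 * t.2%:R.

Lemma sqr_gridv t : gridv t ^+ 2 = t.2%:R ^+ 2.
Proof. by rewrite /gridv exprMn sqrr_sign mul1r. Qed.

(** Rounding toward zero, so that the modulus does not grow and grid points stay in the unit
    ball. *)
Lemma gridv_approx (x : R) : `|x| <= n%:R ->
  exists t, (x - gridv t) ^+ 2 <= 1 /\ gridv t ^+ 2 <= x ^+ 2.
Proof.
move=> xn; have x0 : 0 <= `|x| by [].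
pose k := Num.truncn `|x|.
have /andP[k1 k2] : k%:R <= `|x| < k.+1%:R by apply: truncn_itv.
have kn : (k < n.+1)%N by rewrite ltnS -(ler_nat R) (le_trans k1).
exists (x < 0, Ordinal kn).
rewrite -natr1 in k2.
have xE := numEsign x; move: (x < 0)%R xE => b xE.
rewrite sqr_gridv /= -(real_normK (num_real x)) {1}xE.
rewrite -mulrBr exprMn sqrr_sign mul1r.
have kR : 0 <= k%:R :> R by [].
move: x0 k1 k2 kR; move: `|x| k%:R => X K *; split; nra.
Qed.

Definition gridpt (f : {ffun 'I_n -> bool * 'I_n.+1}) : 'cV[R]_n :=
  \col_i gridv (f i).

Definition unit_gridpt (f : {ffun 'I_n -> bool * 'I_n.+1}) : 'cV[R]_n :=
  n%:R^-1 *: gridpt f.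

Lemma gridpt_approx (x : 'cV[R]_n) : (forall i, `|x i 0| <= n%:R) ->
  exists f, (forall i, (x i 0 - gridpt f i 0) ^+ 2 <= 1) /\
            (forall i, gridpt f i 0 ^+ 2 <= x i 0 ^+ 2).
Proof.
move=> xn; have h i := gridv_approx (xn i).
exists [ffun i => sval (cid (h i))].
by split=> i; rewrite mxE ffunE; case: (cid _) => t [].
Qed.

Lemma dotv_le_mono (x y : 'cV[R]_n) :
  (forall i, x i 0 ^+ 2 <= y i 0 ^+ 2) -> dotv x x <= dotv y y.
Proof. by move=> h; apply: ler_sum => i _; rewrite -!expr2. Qed.

(** With mesh 1 / n, the n coordinates cost at most n (1 / n) ^ 2 in squared norm. *)
Lemma gridpt_unit_approx (x : 'cV[R]_n) : (0 < n)%N -> dotv x x = 1 ->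
  exists f, nrm (x - unit_gridpt f) <= (Num.sqrt n%:R)^-1 /\
    dotv (unit_gridpt f) (unit_gridpt f) <= 1.
Proof.
move=> n0 xx; have nR : 0 < n%:R :> R by rewrite ltr0n.
have [i|f [f1 f2]] := @gridpt_approx (n%:R *: x).
  rewrite mxE normrM ger0_norm // ler_piMr //.
  rewrite -(@ler_pXn2r _ 2) ?nnegrE // expr1n real_normK ?num_real // -xx.
  by rewrite /dotv (bigD1 i) //= -expr2 lerDl sumr_ge0 // => j _; rewrite -expr2 sqr_ge0.
exists f; rewrite /unit_gridpt; set g := _ *: gridpt f.
have gE : gridpt f = n%:R *: g by rewrite scalerA divff ?scale1r // gt_eqF.
clearbody g; split.
  rewrite nrm_le ?invr_ge0 ?sqrtr_ge0 // exprVn sqr_sqrtr //.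
  rewrite -(ler_pM2l (exprn_gt0 2 nR)).
  have <- : dotv (n%:R *: x - gridpt f) (n%:R *: x - gridpt f) =
      n%:R ^+ 2 * dotv (x - g) (x - g).
    by rewrite gE -scalerBr dotvZl dotvZr mulrA expr2.
  rewrite (_ : n%:R ^+ 2 * _ = n%:R); last by field; rewrite gt_eqF.
  rewrite -[X in _ <= X%:R]card_ord -sum1_card natr_sum.
  by apply: ler_sum => i _; rewrite -expr2 [X in X ^+ 2]mxE [X in _ + X]mxE.
have := dotv_le_mono f2; rewrite gE !dotvZl !dotvZr xx mulr1 mulrA.
by rewrite -[X in _ <= X]mulr1 ler_pM2l // mulr_gt0.
Qed.

Lemma card_grid : #|{: {ffun 'I_n -> bool * 'I_n.+1}}| = ((2 * n.+1) ^ n)%N.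
Proof. by rewrite card_ffun card_prod card_bool !card_ord. Qed.

End Grid.

(** * Exponential bounds on the noise through grids *)

Section Events.
Variables (R : realType) (p : R) (s : nat).
Hypotheses (p01 : 0 <= p <= 1) (s0 : (0 < s)%N).
Local Notation n := (s.*2).
Local Notation Omega := {ffun 'I_(s.*2) * 'I_(s.*2) -> bool}.
Local Notation N := (noise p).
Local Notation grid := {ffun 'I_(s.*2) -> bool * 'I_(s.*2).+1}.

Let n0 : (0 < n)%N. Proof. by rewrite double_gt0. Qed.
Let nR : 0 < n%:R :> R. Proof. by rewrite ltr0n. Qed.

Local Notation gpt := (@unit_gridpt R s.*2).

(** For unit x, |N x| is the product of N x with its own direction z. Replacing x, then z, by a grid
    point costs at most n times n ^ (-1/2) each time. *)
Lemma noise_norm_grid (w : Omega) (c : R) : 0 <= c ->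
  (forall f g : grid, dotv (gpt f) (gpt f) <= 1 -> dotv (gpt g) (gpt g) <= 1 ->
     dotv (gpt g) (N w *m gpt f) <= c) ->
  forall x : 'cV[R]_n, nrm (N w *m x) <= (c + 2 * Num.sqrt n%:R) * nrm x.
Proof.
move=> c0 hgrid.
have unit (x : 'cV[R]_n) : dotv x x = 1 ->
    nrm (N w *m x) <= c + 2 * Num.sqrt n%:R.
  move=> xx; set y := N w *m x.
  have [y0|y0] := eqVneq y 0.
    rewrite (_ : nrm y = 0) ?addr_ge0 ?mulr_ge0 ?sqrtr_ge0 //.
    by apply/eqP; rewrite nrm_eq0 y0.
  have ny : nrm y != 0 by rewrite nrm_eq0.
  pose z := (nrm y)^-1 *: y.
  have zz : dotv z z = 1 by rewrite /z dotvZl dotvZr -sqr_nrm; field.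
  have zy : nrm y = dotv z y by rewrite /z dotvZl -sqr_nrm; field.
  have [f [f1 f2]] := gridpt_unit_approx n0 xx.
  have [g [g1 g2]] := gridpt_unit_approx n0 zz.
  rewrite zy (_ : dotv z y = dotv (gpt g) (N w *m gpt f)
     + dotv (gpt g) (N w *m (x - gpt f)) + dotv (z - gpt g) y); last first.
    rewrite -dotvDr -mulmxDr addrC (addrC (gpt f)) subrK -/y.
    by rewrite -dotvDl subrK.
  have sq : n%:R * (Num.sqrt n%:R)^-1 = Num.sqrt n%:R :> R.
    rewrite -{1}(sqr_sqrtr (ltW nR)) expr2 mulfK //.
    by rewrite gt_eqF // sqrtr_gt0.
  have ng : nrm (gpt g) <= 1 by rewrite nrm_le // expr1n.
  have nx : nrm x = 1 by rewrite /nrm xx sqrtr1.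
  have b1 : dotv (gpt g) (N w *m (x - gpt f)) <= Num.sqrt n%:R.
    apply: le_trans (dotv_le _ _) _; rewrite -[X in _ <= X]mul1r -sq.
    apply: ler_pM => //; apply: le_trans (nrm_noise p01 _ _) _.
    by rewrite ler_wpM2l.
  have b2 : dotv (z - gpt g) y <= Num.sqrt n%:R.
    apply: le_trans (dotv_le _ _) _; rewrite -sq mulrC.
    apply: ler_pM => //; apply: le_trans (nrm_noise p01 _ _) _.
    by rewrite nx mulr1.
  by have := hgrid f g f2 g2; lra.
move=> x; have [->|x0] := eqVneq x 0.
  by rewrite mulmx0 (_ : nrm (0 : 'cV[R]_n) = 0) ?mulr0 //; apply/eqP; rewrite nrm_eq0.
have nx : 0 < nrm x by rewrite nrm_gt0.
have := unit ((nrm x)^-1 *: x); rewrite dotvZl dotvZr -scalemxAr nrmZ.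
rewrite ger0_norm ?invr_ge0 // ler_pdivrMl // (mulrC (nrm x)); apply.
by rewrite -sqr_nrm; field; rewrite gt_eqF.
Qed.

(** Chernoff with a union bound over pairs of grid points; the parameter t = c / 8 minimises 4 t ^ 2
    - t c, with value - c ^ 2 / 16. *)
Lemma Prob_grid (c : R) : 0 <= c ->
  Prob p (fun w : Omega => ~ forall f g : grid,
    dotv (gpt f) (gpt f) <= 1 -> dotv (gpt g) (gpt g) <= 1 ->
     dotv (gpt g) (N w *m gpt f) <= c) <=
  ((2 * n.+1) ^ n)%:R ^+ 2 * expR (- (c ^+ 2 / 16)).
Proof.
move=> c0; pose ok (fg : grid * grid) :=
  (dotv (gpt fg.1) (gpt fg.1) <= 1) && (dotv (gpt fg.2) (gpt fg.2) <= 1).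
pose F (w : Omega) := expR (- (c ^+ 2 / 8)) * \sum_(fg : grid * grid | ok fg)
   expR (dotv (c / 8 *: gpt fg.2) (N w *m gpt fg.1)).
apply: le_trans (@Prob_le_expect _ _ _ p01 _ F _ _) _.
- by move=> w; rewrite mulr_ge0 ?expR_ge0 // sumr_ge0 // => *; rewrite expR_ge0.
- move=> w /existsNP[f /existsNP[g /not_implyP[f1 /not_implyP[g1 /negP]]]].
  rewrite -ltNge => cl.
  rewrite /F mulr_sumr (bigD1 (f, g)) /=; last by rewrite /ok f1 g1.
  rewrite -[X in X <= _]addr0; apply: lerD; last first.
    by rewrite sumr_ge0 // => *; rewrite mulr_ge0 ?expR_ge0.
  rewrite -expRD -[X in X <= _]expR0 ler_expR dotvZl addrC subr_ge0.
  rewrite (_ : c ^+ 2 / 8 = c / 8 * c); last by ring.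
  by rewrite ler_wpM2l ?(ltW cl) // divr_ge0.
rewrite expectZ expect_sum mulrC.
apply: le_trans (_ : (\sum_(fg : grid * grid) expR (c ^+ 2 / 16)) * expR (- (c ^+ 2 / 8)) <= _).
  rewrite ler_wpM2r ?expR_ge0 // [X in X <= _]big_mkcond.
  apply: ler_sum => fg _; case: ifP => [/andP[f1 g1]|_]; last exact: expR_ge0.
  apply: le_trans (noise_mgf p01 _ _) _; rewrite ler_expR dotvZl dotvZr.
  have ab : dotv (gpt fg.1) (gpt fg.1) * dotv (gpt fg.2) (gpt fg.2) <= 1.
    by rewrite mulr_ile1.
  have := ler_wpM2l (sqr_ge0 c) ab.
  by move: (dotv _ _) (dotv _ _) => u v; lra.
rewrite sumr_const card_prod card_grid -[X in X * _]mulr_natl -mulrA -expRD.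
rewrite (_ : c ^+ 2 / 16 + _ = - (c ^+ 2 / 16)); last by field.
by rewrite natrM expr2.
Qed.

(** A discrete Gaussian linearisation of the square. If f rounds X = N U, then |X - f| ^ 2 <= n
    bounds |X| ^ 2 - n by 2 <f, X> - |f| ^ 2. Summing the exponentials over all f removes the
    dependence on the outcome, [noise_mgf] turns each term into at most exp (- |f| ^ 2 / 64), and
    the sum factors over coordinates. *)
Lemma expect_noise_sq (U : 'cV[R]_n) : dotv U U = 1 ->
  expect p (fun w => expR (32^-1 * (dotv (N w *m U) (N w *m U) - n%:R))) <=
  (\sum_(t : bool * 'I_n.+1) expR (- (gridv R t ^+ 2 / 64))) ^+ n.
Proof.
move=> UU; have nU : nrm U = 1 by rewrite /nrm UU sqrtr1.
pose F (f : grid) (w : Omega) := expR (- (dotv (gridpt R f) (gridpt R f) / 32)) *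
   expR (dotv (16^-1 *: gridpt R f) (N w *m U)).
apply: le_trans (_ : expect p (fun w => \sum_(f : grid) F f w) <= _).
  apply: le_expect => // w.
  have [i|f [f1 _]] := @gridpt_approx R n (N w *m U).
    rewrite -(@ler_pXn2r _ 2) ?nnegrE // real_normK ?num_real //.
    have := nrm_noise p01 w U; rewrite nU mulr1 nrm_le //; apply: le_trans.
    by rewrite /dotv (bigD1 i) //= -expr2 lerDl sumr_ge0 // => j _; rewrite -expr2 sqr_ge0.
  rewrite (bigD1 f) //= -[X in X <= _]addr0; apply: lerD; last first.
    by rewrite sumr_ge0 // => g _; rewrite mulr_ge0 ?expR_ge0.
  rewrite /F -expRD ler_expR dotvZl; move: (N w *m U) f1 => X f1.
  have : dotv (X - gridpt R f) (X - gridpt R f) <= n%:R.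
    rewrite -[X in _ <= X%:R]card_ord -sum1_card natr_sum.
    by apply: ler_sum => i _; rewrite -expr2 [X in X ^+ 2]mxE [X in _ + X]mxE.
  rewrite !dotvE (dotvC X (gridpt R f)).
  by move: (dotv _ _) (dotv _ _) (dotv _ _) => *; lra.
rewrite expect_sum; apply: le_trans (_ :
    \sum_(f : grid) expR (- (dotv (gridpt R f) (gridpt R f) / 64)) <= _).
  apply: ler_sum => f _; rewrite expectZ.
  apply: le_trans (ler_wpM2l (expR_ge0 _) (noise_mgf p01 _ _)) _.
  rewrite -expRD ler_expR UU dotvZl dotvZr.
  by move: (dotv _ _) => u; lra.
rewrite -[X in _ ^+ X]card_ord -prodr_const bigA_distr_bigA.
apply: ler_sum => f _; rewrite -expR_sum ler_expR /dotv mulr_suml -sumrN.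
by apply: ler_sum => i _; rewrite !mxE -expr2.
Qed.

End Events.

(** * A discrete Gaussian sum *)

Section GaussianSum.
Variable R : realType.

(** Comparison with a geometric series: (k / 8 - 1) ^ 2 >= 0 gives k ^ 2 / 64 >= k / 4 - 1. The
    bound is an exponential because it will be raised to the power n. *)
Lemma gaussian_sum_le : exists K : R, 0 <= K /\
  forall m, \sum_(t : bool * 'I_m.+1) expR (- (gridv R t ^+ 2 / 64)) <= expR K.
Proof.
pose r : R := expR (- 4^-1).
have r1 : r < 1 by rewrite expR_lt1 oppr_lt0 invr_gt0.
have r0 : 0 < r by apply: expR_gt0.
pose B := expR 1 / (1 - r).
have B0 : 0 <= B by rewrite divr_ge0 ?expR_ge0 // subr_ge0 ltW.
exists (2 * B); split=> [|m]; first by rewrite mulr_ge0.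
apply: le_trans (_ : 2 * B <= _); last by apply: le_trans (expR_ge1Dx _); rewrite lerDr.
rewrite -(pair_bigA _ (fun (b : bool) (k : 'I_m.+1) => expR (- (gridv R (b, k) ^+ 2 / 64)))) /=.
have half b : \sum_(k < m.+1) expR (- (gridv R (b, k) ^+ 2 / 64)) <= B.
  apply: le_trans (_ : \sum_(k < m.+1) expR 1 * r ^+ k <= _).
    apply: ler_sum => k _; rewrite sqr_gridv /=.
    rewrite /r -expRM_natl -expRD ler_expR.
    have := sqr_ge0 (k%:R / 8 - 1 : R); set c : R := k%:R; lra.
  rewrite -mulr_sumr ler_wpM2l ?expR_ge0 //.
  rewrite -[X in _ <= X]mul1r ler_pdivlMr ?subr_gt0 // mulrC.
  have := subrX1 r m.+1 => h.
  by rewrite -opprB mulNr -h opprB gerBl exprn_ge0 // (ltW r0).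
by rewrite big_bool /=; have := lerD (half true) (half false); lra.
Qed.

End GaussianSum.

(** * Numerical tail estimates *)

Section Tail.
Variable R : realType.

Lemma expR_ge_pow4 (x : R) : 0 <= x -> (x / 4) ^+ 4 <= expR x.
Proof.
move=> x0; rewrite {2}(_ : x = 4%:R * (x / 4)); last by field.
rewrite expRM_natl ler_pXn2r ?nnegrE ?divr_ge0 ?expR_ge0 //.
by apply: le_trans (expR_ge1Dx _); rewrite lerDr.
Qed.

Lemma two_expRN_le (n : R) : 2 ^+ 9 <= n -> 2 * expR (- n) <= (n ^+ 3)^-1.
Proof.
move=> nL; have n0 : 0 < n by lra.
have n3 : 0 < n ^+ 3 by rewrite exprn_gt0.
rewrite expRN ler_pdivrMr ?expR_gt0 // mulrC ler_pdivlMr //.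
apply: le_trans (expR_ge_pow4 (ltW n0)).
rewrite (_ : (n / 4) ^+ 4 = n / 2 ^+ 8 * n ^+ 3); last by field.
by rewrite ler_wpM2r ?(ltW n3) // ler_pdivlMr //; lra.
Qed.

(** Taking n-th roots reduces the claim to (2 n + 2) ^ 2 <= exp (y - 1). The first threshold says y
    >= 2, so y - 1 >= y / 2; the second says 4 n <= (y / 8) ^ 2, and exp (y / 2) >= (y / 8) ^ 4. *)
Lemma union_bound_tail (eta : R) (n : nat) : 0 < eta -> (0 < n)%N ->
  2 ^+ 5 / eta ^+ 2 <= n%:R -> 4 * (2 ^+ 7 / eta ^+ 2) ^+ 2 <= n%:R ->
  ((2 * n.+1) ^ n)%:R ^+ 2 * expR (- ((eta * n%:R) ^+ 2 / 16)) <= expR (- n%:R).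
Proof.
move=> eta0 n0 n1 n2; have nR : 1 <= n%:R :> R by rewrite ler1n.
pose y := eta ^+ 2 * n%:R / 16.
have e2 : 0 < eta ^+ 2 by rewrite exprn_gt0.
have y2 : 2 <= y.
  by move: n1; rewrite ler_pdivrMr // /y mulrC; lra.
have h4 : 4 * n%:R <= (y / 2 / 4) ^+ 2.
  rewrite (_ : (y / 2 / 4) ^+ 2 = n%:R * (n%:R / (2 ^+ 7 / eta ^+ 2) ^+ 2)); last first.
    by rewrite /y; field; rewrite gt_eqF.
  rewrite mulrC ler_pM2l; last by lra.
  by rewrite ler_pdivlMr // exprn_gt0 // divr_gt0.
have key : (2 * n.+1%:R) ^+ 2 <= expR (y - 1).
  apply: le_trans (_ : expR (y / 2) <= _); last by rewrite ler_expR; lra.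
  apply: le_trans (expR_ge_pow4 _); last by lra.
  rewrite (exprM (y / 2 / 4) 2 2) ler_pXn2r ?nnegrE ?sqr_ge0 //.
  by apply: le_trans h4; rewrite -natr1; lra.
rewrite natrX -exprM (mulnC n 2) exprM.
rewrite (_ : - ((eta * n%:R) ^+ 2 / 16) = n%:R * - y); last by rewrite /y; field.
rewrite (_ : - n%:R = n%:R * -1 :> R); last by ring.
rewrite !expRM_natl -exprMn ler_pXn2r ?nnegrE ?mulr_ge0 ?expR_ge0 ?sqr_ge0 //.
rewrite -ler_pdivlMr ?expR_gt0 // -expRN opprK -expRD addrC natrM.
exact: key.
Qed.

End Tail.

(** * Probabilities of the two noise estimates *)

Section GoodEvent.
Variables (R : realType) (p : R).
Hypotheses (hp0 : 0 < p) (hp1 : p < 1).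
Local Notation eps := ((1 / 10) ^+ 3 : R).

Let p01 : 0 <= p <= 1. Proof. by rewrite !ltW. Qed.

Lemma Prob_noise_norm : exists L : R, forall s : nat, L <= s%:R -> (0 < s)%N ->
  Prob p (fun w => ~ forall x : 'cV[R]_(s.*2),
    nrm (noise p w *m x) <= eps / 2 * (p * s%:R) * nrm x) <= expR (- (s.*2)%:R).
Proof.
(* With n = 2 s, twice eta n is the target eps / 2 * (p s): one half serves the grid bound, the
   other the rounding error 2 sqrt n. *)
pose eta := eps * p / 8.
have eta0 : 0 < eta by rewrite /eta; move: hp0; lra.
have e2 : 0 < eta ^+ 2 by rewrite exprn_gt0.
exists (2 ^+ 5 / eta ^+ 2 + 4 * (2 ^+ 7 / eta ^+ 2) ^+ 2) => s sL s0.
have n0 : (0 < s.*2)%N by rewrite double_gt0.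
have a1 : 0 <= 2 ^+ 5 / eta ^+ 2 by rewrite divr_ge0 // ltW.
have a2 : 0 <= 4 * (2 ^+ 7 / eta ^+ 2) ^+ 2 by rewrite mulr_ge0 ?sqr_ge0.
have nE : (s.*2)%:R = 2 * s%:R :> R by rewrite -mul2n natrM.
have s0R : 0 <= s%:R :> R by [].
have n1 : 2 ^+ 5 / eta ^+ 2 <= (s.*2)%:R by rewrite nE; lra.
have n2 : 4 * (2 ^+ 7 / eta ^+ 2) ^+ 2 <= (s.*2)%:R by rewrite nE; lra.
have nR : 0 < (s.*2)%:R :> R by rewrite ltr0n.
apply: le_trans (union_bound_tail eta0 n0 n1 n2).
have c0 : 0 <= eta * (s.*2)%:R by rewrite mulr_ge0 // ltW.
have hgrid := Prob_grid s p01 c0; apply: (le_trans _ hgrid).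
apply: le_Prob => // w; apply: contra_not => hg x.
apply: le_trans (noise_norm_grid p01 s0 c0 hg x) _.
rewrite ler_wpM2r //.
suff : 2 * Num.sqrt (s.*2)%:R <= eta * (s.*2)%:R.
  by rewrite nE /eta; lra.
have q0 : 0 <= 2 * Num.sqrt (s.*2)%:R :> R by rewrite mulr_ge0 ?sqrtr_ge0.
rewrite -(@ler_pXn2r _ 2) ?nnegrE // exprMn sqr_sqrtr ?(ltW nR) //.
rewrite exprMn [X in _ <= _ * X]expr2 mulrA ler_pM2r //.
by move: n1; rewrite ler_pdivrMr //; lra.
Qed.

(** Here U is fixed in advance. Markov at exponent 1 / 32 leaves exp (- (1 + k) n) against a moment
    of at most exp (k n), which explains 1 + 32 (1 + k). *)
Lemma Prob_noise_vec : exists K : R, 0 <= K /\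
  forall (s : nat) (U : 'cV[R]_(s.*2)), (0 < s)%N -> dotv U U = 1 ->
  Prob p (fun w => ~ dotv (noise p w *m U) (noise p w *m U) <= K * (s.*2)%:R)
    <= expR (- (s.*2)%:R).
Proof.
have [k [k0 kE]] := gaussian_sum_le R.
exists (1 + 32 * (1 + k)); split; first by lra.
move=> s U s0 UU; set n := (s.*2)%:R; set K := 1 + _.
pose F w := expR (- ((1 + k) * n)) *
  expR (32^-1 * (dotv (noise p w *m U) (noise p w *m U) - n)).
apply: le_trans (@Prob_le_expect _ _ _ p01 _ F _ _) _.
- by move=> w; rewrite mulr_ge0 ?expR_ge0.
- move=> w /negP; rewrite -ltNge => h.
  by rewrite /F -expRD -[X in X <= _]expR0 ler_expR; move: h; rewrite /K; lra.
rewrite expectZ.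
have := expect_noise_sq p01 UU; rewrite -/n => hE.
apply: le_trans (ler_wpM2l (expR_ge0 _) hE) _.
apply: le_trans (_ : expR (- ((1 + k) * n)) * expR k ^+ s.*2 <= _).
  rewrite ler_wpM2l ?expR_ge0 // ler_pXn2r ?double_gt0 ?nnegrE ?expR_ge0 //.
  by apply: sumr_ge0 => t _; apply: expR_ge0.
by rewrite -expRM_natl -expRD ler_expR /n; lra.
Qed.

End GoodEvent.

(** * From squared error to inversion counts *)

Section Kendall.
Variable R : realType.

(** At an inverted pair the errors a, b of y at i, j satisfy b - a >= d, so d ^ 2 <= 2 (a ^ 2 + b ^
    2). Summed over all pairs, each index appears n times on either side, whence 4 n. *)
Lemma kendall_count n (k r d : R) (y U : 'cV[R]_n) :
  0 <= d ->
  (forall i j : 'I_n, i%:R + k <= j%:R -> d <= U i 0 - U j 0) ->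
  (Dkr k r y)%:R * d ^+ 2 <= 4 * n%:R * dotv (y - U) (y - U).
Proof.
move=> d0 Ud; rewrite /Dkr; set S := [set _ | _].
pose e (i : 'I_n) := (y i 0 - U i 0) ^+ 2.
have eE : dotv (y - U) (y - U) = \sum_i e i.
  by apply: eq_bigr => i _; rewrite !mxE -expr2.
rewrite -sum1_card natr_sum mulr_suml.
apply: le_trans (_ : \sum_(ij : 'I_n * 'I_n) 2 * (e ij.1 + e ij.2) <= _).
  rewrite big_mkcond; apply: ler_sum => -[i j] _ /=.
  case: ifP => [|_]; last by rewrite mulr_ge0 ?addr_ge0 ?sqr_ge0.
  rewrite inE /= -[i.+1%:R]natr1 -[j.+1%:R]natr1 => /and3P[yij ijk _].
  have {}Ud : d <= U i 0 - U j 0 by apply: Ud; lra.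
  rewrite mul1r /e; have := sqr_ge0 ((y i 0 - U i 0) + (y j 0 - U j 0)).
  set a := y i 0 - U i 0; set b := y j 0 - U j 0 => ab.
  have : d ^+ 2 <= (b - a) ^+ 2.
    by rewrite ler_pXn2r ?nnegrE // /a /b; lra.
  by lra.
rewrite -mulr_sumr -(pair_bigA _ (fun i j => e i + e j)) /=.
have -> : \sum_i \sum_j (e i + e j) = n%:R * (\sum_i e i) + n%:R * \sum_i e i.
  transitivity (\sum_(i < n) (n%:R * e i + \sum_j e j)).
    apply: eq_bigr => i _.
    by rewrite big_split /= sumr_const card_ord mulr_natl.
  by rewrite big_split /= -mulr_sumr sumr_const card_ord mulr_natl.
by rewrite eE; move: (\sum_i e i) => S0; lra.
Qed.

Lemma Dkr_card n (k r : R) (y : 'cV[R]_n) : (Dkr k r y <= n ^ 2)%N.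
Proof.
by rewrite (leq_trans (max_card _)) // card_prod !card_ord mulnn.
Qed.

(** Serves small n: there are at most n ^ 2 pairs, and none unless k <= n. *)
Lemma Dkr_pow4_le n (k r : R) (y : 'cV[R]_n) : 0 <= k ->
  (Dkr k r y)%:R * k ^+ 4 <= n%:R ^+ 6.
Proof.
move=> k0; have [D0|Dpos] := posnP (Dkr k r y).
  by rewrite D0 mul0r exprn_ge0.
have kn : k <= n%:R.
  move: Dpos; rewrite card_gt0 => /set0Pn[[i j]]; rewrite inE /= => /and3P[_ h _].
  have := ltn_ord j; rewrite -(ler_nat R) => jn.
  have : 0 <= i.+1%:R :> R by [].
  by lra.
rewrite (exprD _ 2 4); apply: ler_pM => //; first by rewrite exprn_ge0.
  by rewrite -natrX ler_nat Dkr_card.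
by rewrite ler_pXn2r ?nnegrE.
Qed.

(** Combines the gap of u with theta >= 1 / (2 n), which follows from pi >= 2, and |u| <= sqrt n. *)
Lemma unitv_uvec_gap s (k : R) (i j : 'I_(s.*2)) : (0 < s)%N -> 0 <= k ->
  i%:R + k <= j%:R ->
  (k / (2 * (s.*2)%:R)) ^+ 2 / 2 / Num.sqrt (s.*2)%:R <=
  unitv (uvec R s) i 0 - unitv (uvec R s) j 0.
Proof.
move=> s0 k0 ijk; have h := uvec_gap s0 k0 ijk.
have s1 : 1 <= s%:R :> R by rewrite ler1n.
have nE : (s.*2)%:R = 2 * s%:R :> R by rewrite -mul2n natrM.
have un : 0 < nrm (uvec R s) by rewrite nrm_gt0 uvec_neq0.
have thle : (2 * (s.*2)%:R)^-1 <= theta R s.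
  rewrite nE /theta -[X in X <= _]mul1r.
  rewrite ler_pdivrMr ?mulr_gt0 //; try lra.
  rewrite mulrAC ler_pdivlMr; last by lra.
  by have := pi_ge2 R; nra.
rewrite [unitv _ i 0]mxE [unitv _ j 0]mxE -mulrBr [X in _ <= X]mulrC ler_pdivlMr //.
apply: le_trans h.
apply: le_trans (_ : (k * theta R s) ^+ 2 / 2 / Num.sqrt (s.*2)%:R * nrm (uvec R s) <= _).
  rewrite (ler_wpM2r (ltW un)) // ler_wpM2r ?invr_ge0 ?sqrtr_ge0 // ler_wpM2r ?invr_ge0 //.
  have a0 : 0 <= k / (2 * (s.*2)%:R) by rewrite divr_ge0 // mulr_ge0.
  have b0 : 0 <= k * theta R s by exact: mulr_ge0 k0 (ltW (theta_gt0 R s)).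
  by rewrite ler_pXn2r ?nnegrE // ler_wpM2l.
rewrite -mulrA ler_piMr ?divr_ge0 ?sqr_ge0 //.
rewrite mulrC ler_pdivrMr ?sqrtr_gt0 ?nE; last by lra.
rewrite mul1r nrm_le ?sqrtr_ge0 // sqr_sqrtr; last by lra.
exact: uvec_norm_le.
Qed.

End Kendall.

(** * Assembly of the high-probability bound *)

Section Conclusion.
Variables (R : realType) (p : R).
Hypotheses (hp0 : 0 < p) (hp1 : p < 1).
Local Notation eps := ((1 / 10) ^+ 3 : R).
Let p01 : 0 <= p <= 1. Proof. by rewrite !ltW. Qed.

(** Uniform in k and r, so that one event serves all exponents; multiplying by k ^ 4 avoids dividing
    by a possibly zero k. *)
Definition kendall_good (C : R) s (w : {ffun 'I_(s.*2) * 'I_(s.*2) -> bool}) :=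
  forall l (y : 'cV[R]_(s.*2)),
    is_lambda2 (Mhat R w) l -> Mhat R w *m y = l *: y -> dotv y y = 1 ->
    0 <= dotv y (uvec R s) ->
    forall k r : R, 0 <= k ->
    (Dkr k r y)%:R * k ^+ 4 <= C * (s.*2)%:R ^+ 5.

Lemma kendall_good_small (C : R) s w : (s.*2)%:R <= C -> @kendall_good C s w.
Proof.
move=> sC l y _ _ _ _ k r k0; apply: le_trans (Dkr_pow4_le _ _ k0) _.
by rewrite exprS ler_wpM2r ?exprn_ge0.
Qed.

Lemma Mhat_sym s (w : {ffun 'I_(s.*2) * 'I_(s.*2) -> bool}) : (Mhat R w)^T = Mhat R w.
Proof.
apply/matrixP => i j; rewrite !mxE.
by case: (ltngtP i j) => // /val_inj ->.
Qed.

Lemma kendall_good_noise (K : R) s (w : {ffun 'I_(s.*2) * 'I_(s.*2) -> bool}) :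
  2 * 10 ^+ 3 <= s%:R :> R ->
  (forall x : 'cV[R]_(s.*2),
    nrm (noise p w *m x) <= eps / 2 * (p * s%:R) * nrm x) ->
  let U := unitv (uvec R s) in
  dotv (noise p w *m U) (noise p w *m U) <= K * (s.*2)%:R ->
  kendall_good (2 ^+ 11 * (2 * 10 ^+ 3) ^+ 2 * K / p ^+ 2) w.
Proof.
move=> sL hE U hU l y lam Ay yy yu k r k0.
have sR : 0 < s%:R :> R by lra.
have s0 : (0 < s)%N by rewrite -(ltr0n R).
have nE : (s.*2)%:R = 2 * s%:R :> R by rewrite -mul2n natrM.
have nR : 0 < (s.*2)%:R :> R by lra.
have close := second_eigvec_close hp0 sL (Mhat_sym w) lam hE Ay yy yu.
rewrite -/U -/(noise p w) in close.
have T2 : 0 < (p * s%:R) ^+ 2 by rewrite exprn_gt0 // mulr_gt0.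
have {}close : dotv (y - U) (y - U) <=
    2 * (2 * 10 ^+ 3) ^+ 2 / (p * s%:R) ^+ 2 * (K * (s.*2)%:R).
  apply: le_trans close _; rewrite ler_wpM2l //.
  exact: divr_ge0 (mulr_ge0 (ler0n _ _) (sqr_ge0 _)) (ltW T2).
have d0 : 0 <= (k / (2 * (s.*2)%:R)) ^+ 2 / 2 / Num.sqrt (s.*2)%:R :> R.
  by rewrite !divr_ge0 ?sqr_ge0 ?sqrtr_ge0.
have := kendall_count r y d0 (fun i j => @unitv_uvec_gap R s k i j s0 k0).
rewrite -/U; set D := (Dkr k r y)%:R => count.
(* The squared gap is k ^ 4 / (2 ^ 6 n ^ 5); the remaining 2 ^ 5 of the constant is 4 * 2 times the
   4 from s = n / 2. *)
have {}count : D * (k ^+ 4 / (2 ^+ 6 * (s.*2)%:R ^+ 5)) <=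
    4 * (s.*2)%:R * dotv (y - U) (y - U).
  apply: le_trans count; rewrite expr_div_n sqr_sqrtr ?(ltW nR) //.
  rewrite le_eqVlt; apply/orP; left; apply/eqP; field.
  by rewrite gt_eqF.
have {}count := le_trans count (ler_wpM2l (mulr_ge0 (ler0n R 4) (ltW nR)) close).
have n5 : 0 < 2 ^+ 6 * (s.*2)%:R ^+ 5 :> R by rewrite mulr_gt0 ?exprn_gt0.
rewrite mulrA ler_pdivrMr // in count.
apply: le_trans count _; rewrite le_eqVlt; apply/orP; left; apply/eqP.
by rewrite nE; field; rewrite !gt_eqF.
Qed.

Lemma kendall_good_whp : exists C : R, 0 <= C /\
  forall s, (0 < s)%N ->
    1 - ((s.*2)%:R ^+ 3)^-1 <= Prob p (fun w => @kendall_good C s w).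
Proof.
have [L HL] := Prob_noise_norm hp0 hp1; have [K [K0 HK]] := Prob_noise_vec hp0 hp1.
pose C1 : R := 2 ^+ 11 * (2 * 10 ^+ 3) ^+ 2 * K / p ^+ 2.
have C10 : 0 <= C1 by rewrite divr_ge0 ?sqr_ge0 // !mulr_ge0 // ?sqr_ge0 ?exprn_ge0.
pose S : R := `|L| + 2 * 10 ^+ 3.
have S0 : 0 <= S by rewrite addr_ge0.
(* The term 2 S covers s <= S, where n <= 2 S and the trivial count suffices; [C1] covers larger
   s. *)
exists (C1 + 2 * S); split; first by rewrite addr_ge0 // mulr_ge0.
move=> s s0; have nE : (s.*2)%:R = 2 * s%:R :> R by rewrite -mul2n natrM.
apply: (le_trans _ (Prob_compl p _)).
rewrite lerD2l lerN2.
have [small|large] := leP s%:R S.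
  rewrite /Prob big1 ?invr_ge0 ?exprn_ge0 // => w /asboolP; case.
  by apply: kendall_good_small; rewrite nE; lra.
have sL : 2 * 10 ^+ 3 <= s%:R :> R.
  by have := normr_ge0 L; rewrite /S in large; lra.
have sL' : L <= s%:R by have := ler_norm L; rewrite /S in large; lra.
have UU := dotv_unitv (uvec_neq0 R s0).
apply: (le_trans _ (two_expRN_le _)); last by rewrite nE; lra.
rewrite [2 * expR _]mulr_natl [_ *+ 2]mulr2n.
apply: (le_trans _ (lerD (HL s sL' s0) (HK s _ s0 UU))).
apply: (le_trans _ (Prob_or p01 _ _)); apply: le_Prob => // w bad.
apply: contrapT => /not_orP[/contrapT hE /contrapT hU]; apply: bad.
move=> l y lam Ay yy yu k r k0.
apply: le_trans (kendall_good_noise sL hE hU lam Ay yy yu r k0) _.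
by rewrite ler_wpM2r ?exprn_ge0 // lerDl mulr_ge0.
Qed.

End Conclusion.

Theorem theorem2 (R : realType) (p alpha beta : R)
  (hp0 : 0 < p) (hp1 : p < 1) (ha : 0 <= alpha) (hb : 0 <= beta) :
  exists C : R, 0 < C /\
  forall s : nat, (0 < s)%N ->
    1 - ((s.*2)%:R ^+ 3)^-1 <=
    Prob p (fun w : {ffun 'I_(s.*2) * 'I_(s.*2) -> bool} =>
      forall (l : R) (y : 'cV[R]_(s.*2)),
        is_lambda2 (Mhat R w) l ->
        Mhat R w *m y = l *: y ->
        dotv y y = 1 ->
        0 <= dotv y (uvec R s) ->
        let n : R := (s.*2)%:R in
        let r := powR n alpha in
        let k := powR n beta in
        if alpha <= beta
        then (Dkr k r y)%:R < C * powR n (5 - 2 * (alpha + beta))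
        else (Dkr k r y)%:R < C * powR n (5 - 4 * beta)).
Proof.
have [C [C0 HC]] := kendall_good_whp hp0 hp1.
(* Adding 1 makes the constant positive and the final inequality strict. *)
exists (C + 1); split; first by rewrite ltr_wpDl.
move=> s s0; apply: le_trans (HC s s0) _.
apply: le_Prob => [|w good l y lam Ay yy yu]; first by rewrite !ltW.
cbv zeta; set n : R := (s.*2)%:R; set r := n `^ alpha; set k := n `^ beta.
have n1 : 1 <= n by rewrite /n ler1n double_gt0.
have n0 : 0 < n by lra.
have := good l y lam Ay yy yu k r (powR_ge0 _ _).
have k4 : k ^+ 4 = n `^ (4 * beta) by rewrite mulrC powRrM powR_mulrn ?powR_ge0.
have k0 : 0 < k ^+ 4 by rewrite k4 powR_gt0.
rewrite -ler_pdivlMr // -/n -powR_mulrn ?(ltW n0) // k4 -mulrA -powRB; last first.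
  by rewrite (gt_eqF n0) implybT.
move=> bound; have lt : (Dkr k r y)%:R < (C + 1) * n `^ (5 - 4 * beta).
  by apply: le_lt_trans bound _; rewrite ltr_pM2r ?powR_gt0 // ltrDl.
(* When alpha <= beta, 5 - 4 beta <= 5 - 2 (alpha + beta), and n >= 1. *)
case: ifP => // ab; apply: lt_le_trans lt _.
by rewrite ler_wpM2l ?addr_ge0 // ler_powR //; lra.
Qed.
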